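(* Let $(H,\sigma)$ be sampled from $\mathcal H(n,d,p_n,q_n)$, with self-avoiding matrices $B^{(l)}$, and let $\Delta^{(l)}$ and $\overline A$ be as in the context. Then there exist random $n\times n$ matrices $\Gamma^{(l,m)}$, $1\le m\le l$ (functions of $(H,\sigma)$), such that: (1) for every $l\ge1$, $$B^{(l)}=\Delta^{(l)}+\sum_{m=1}^l \Delta^{(l-m)}\overline A B^{(m-1)}-\sum_{m=1}^l\Gamma^{(l,m)};$$ (2) for any sequence $l_n=O(\log n)$ and any fixed $\epsilon>0$, $$\lim_{n\to\infty}\mathbb P_{\mathcal H_n}\big(\rho(\Delta^{(l_n)})\le n^{\epsilon}\alpha^{l_n/2}\big)=1,\qquad \lim_{n\to\infty}\mathbb P_{\mathcal H_n}\Big(\bigcap_{m=1}^{l_n}\big\{\rho(\Gamma^{(l_n,m)})\le n^{\epsilon-1}\alpha^{(l_n+m)/2}\big\}\Big)=1.$$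
   Context: Fix an integer $d\ge3$ and constants $a\ge b>0$; $p_n=a/\binom{n}{d-1}$, $q_n=b/\binom{n}{d-1}$. Under $\mathcal H(n,d,p_n,q_n)$, $\sigma\in\{-1,+1\}^n$ has i.i.d. uniform entries, and given $\sigma$ each $d$-subset $e\subset[n]$ is independently a hyperedge of $H$ with probability $p_n$ if all spins in $e$ agree and $q_n$ otherwise; $\mathbb P_{\mathcal H_n},\mathbb E_{\mathcal H_n}$ denote probability/expectation under this law. $\alpha=(d-1)\frac{a+(2^{d-1}-1)b}{2^{d-1}}$; throughout $\alpha>1$ and $\beta=(d-1)\frac{a-b}{2^{d-1}}>1$. $\rho(M)=\sup_{\|x\|_2=1}\|Mx\|_2$ is the spectral norm. For a $d$-subset $e$ and $i\ne j$, $A^e_{ij}=1$ if $\{i,j\}\subset e$ and $e$ is a hyperedge of $H$, and $0$ otherwise; $A^e_{ii}=0$. The adjacency matrix is $A_{ij}=\sum_e A^e_{ij}$, and $\overline A=\mathbb E_{\mathcal H_n}[A\mid\sigma]$, $\overline A^e_{ij}=\mathbb E_{\mathcal H_n}[A^e_{ij}\mid\sigma]$. A walk of length $l$ is $(i_0,e_1,i_1,\dots,e_l,i_l)$ with $i_{j-1}\ne i_j$, $\{i_{j-1},i_j\}\subset e_j$; it is self-avoiding if $i_0,\dots,i_l$ are distinct, $e_{j-1}\cap e_j=\{i_{j-1}\}$ for $2\le j\le l$, and $e_j\cap e_k=\emptyset$ for $k\ge j+2$. $\mathrm{SAW}_{ij}$ is the set of self-avoiding walks of length $l$ from $i$ to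 $j$ in the complete $d$-uniform hypergraph on $[n]$ (all $d$-subsets are hyperedges). For $l\ge1$, $B^{(l)}_{ij}=\sum_{w\in \mathrm{SAW}_{ij}}\prod_{t=1}^l A^{e_t}_{i_{t-1}i_t}$ for $i\ne j$ (the number of self-avoiding walks of length $l$ from $i$ to $j$ in $H$) and $B^{(l)}_{ii}=0$; and $\Delta^{(l)}_{ij}=\sum_{w\in\mathrm{SAW}_{ij}}\prod_{t=1}^l(A^{e_t}_{i_{t-1}i_t}-\overline A^{e_t}_{i_{t-1}i_t})$, where $w=(i_0,e_1,\dots,e_l,i_l)$. For $l=0$ the only self-avoiding walk of length $0$ from $i$ to $j$ is $(i)$ when $i=j$ (none otherwise), so $B^{(0)}=\Delta^{(0)}=I$. *)

(* Defs.v *)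
From HB Require Import structures.
From mathcomp Require Import all_boot all_order all_algebra.
From mathcomp Require Import all_classical all_reals all_analysis.
Set Implicit Arguments. Unset Strict Implicit. Unset Printing Implicit Defensive.
Import Order.TTheory GRing.Theory Num.Theory.
Import numFieldNormedType.Exports.
Local Open Scope ring_scope.


Definition alpha {R : realType} (d : nat) (a b : R) : R :=
  (d.-1)%:R * (a + (2 ^+ d.-1 - 1) * b) / 2 ^+ d.-1.
Definition beta {R : realType} (d : nat) (a b : R) : R :=
  (d.-1)%:R * (a - b) / 2 ^+ d.-1.

(* p_n = a / C(n,d-1), q_n = b / C(n,d-1), clipped at 1 so that the model is
   a genuine probability distribution for every n (irrelevant for large n). *)
Definition pn {R : realType} (d : nat) (a : R) (n : nat) : R :=
  Num.min 1 (a / ('C(n, d.-1))%:R).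

(* spins: true = +1, false = -1 *)
Definition spins (n : nat) := {ffun 'I_n -> bool}.
Definition hgraph (n : nat) := {set {set 'I_n}}.
Definition dsets (d n : nat) : {set {set 'I_n}} := [set e : {set 'I_n} | #|e| == d].

Definition agree (n : nat) (s : spins n) (e : {set 'I_n}) : bool :=
  [forall i in e, forall j in e, s i == s j].

Definition edge_prob {R : realType} (d : nat) (a b : R) (n : nat)
  (s : spins n) (e : {set 'I_n}) : R :=
  if agree s e then pn d a n else pn d b n.

Definition weight {R : realType} (d : nat) (a b : R) (n : nat)
  (s : spins n) (H : hgraph n) : R :=
  2 ^- n * \prod_(e in dsets d n)
     (if e \in H then edge_prob d a b s e else 1 - edge_prob d a b s e).

Definition Prob {R : realType} (d : nat) (a b : R) (n : nat)
  (E : spins n -> hgraph n -> Prop) : R :=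
  \sum_(s : spins n) \sum_(H : hgraph n | H \subset dsets d n)
     (if `[< E s H >] then weight d a b s H else 0).

Definition Ae {R : realType} (n : nat) (H : hgraph n) (e : {set 'I_n})
  (i j : 'I_n) : R :=
  ((i != j) && (i \in e) && (j \in e) && (e \in H))%:R.

(* \overline A^e_{ij} = E[A^e_{ij} | sigma] *)
Definition Abare {R : realType} (d : nat) (a b : R) (n : nat) (s : spins n)
  (e : {set 'I_n}) (i j : 'I_n) : R :=
  ((i != j) && (i \in e) && (j \in e))%:R * edge_prob d a b s e.

Definition Amat {R : realType} (d n : nat) (H : hgraph n) : 'M[R]_n :=
  \matrix_(i, j) \sum_(e in dsets d n) Ae H e i j.

Definition Abar {R : realType} (d : nat) (a b : R) (n : nat) (s : spins n)
  : 'M[R]_n :=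
  \matrix_(i, j) \sum_(e in dsets d n) Abare d a b s e i j.

(* (vs, es) = (i_0, e_1, i_1, ..., e_l, i_l) is a self-avoiding walk of length l
   from i to j in the complete d-uniform hypergraph on [n];
   vertex i_k = nth i vs k, hyperedge e_t = nth (finset.set0 : {set 'I_n}) es t.-1 (1 <= t <= l). *)
Definition is_saw (d n l : nat) (i j : 'I_n) (vs : (l.+1).-tuple 'I_n)
  (es : l.-tuple {set 'I_n}) : bool :=
  let v k := nth i vs k in
  let E t := nth (finset.set0 : {set 'I_n}) es t.-1 in
  [&& v 0%N == i, v l == j, uniq vs,
      [forall t : 'I_l.+1, (0 < t)%N ==>
         [&& #|E t| == d, v t.-1 != v t, v t.-1 \in E t & v t \in E t]],
      [forall t : 'I_l.+1, (2 <= t)%N ==> (E t.-1 :&: E t == [set v t.-1])] &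
      [forall t : 'I_l.+1, forall k : 'I_l.+1,
         ((1 <= t)%N && (t.+2 <= k)%N) ==> (E t :&: E k == finset.set0)]].

Definition Bmat {R : realType} (d n : nat) (H : hgraph n) (l : nat) : 'M[R]_n :=
  \matrix_(i, j) \sum_(vs : (l.+1).-tuple 'I_n)
     \sum_(es : l.-tuple {set 'I_n} | is_saw d i j vs es)
       \prod_(t < l) Ae H (nth (finset.set0 : {set 'I_n}) es t) (nth i vs t) (nth i vs t.+1).

Definition Delta {R : realType} (d : nat) (a b : R) (n : nat) (s : spins n)
  (H : hgraph n) (l : nat) : 'M[R]_n :=
  \matrix_(i, j) \sum_(vs : (l.+1).-tuple 'I_n)
     \sum_(es : l.-tuple {set 'I_n} | is_saw d i j vs es)
       \prod_(t < l) (Ae H (nth (finset.set0 : {set 'I_n}) es t) (nth i vs t) (nth i vs t.+1)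
                      - Abare d a b s (nth (finset.set0 : {set 'I_n}) es t) (nth i vs t) (nth i vs t.+1)).

Definition rho {R : realType} (n : nat) (M : 'M[R]_n) : R :=
  sup (fun r : R => exists x : 'cV[R]_n,
         \sum_k (x k ord0) ^+ 2 = 1 /\
         r = Num.sqrt (\sum_k ((M *m x) k ord0) ^+ 2)).
Arguments Prob {R} d a b n E.

(* Main.v *)
(* Writing A = (A - Abar) + Abar along a self-avoiding walk and telescoping gives
   the decomposition; Gamma^(l,m) collects the concatenations (walk of length
   l - m, bridge weighted by Abar, walk of length m - 1) that are not self-avoiding.

   The norm of M = Delta or Gamma is bounded through E tr (M^T M)^k for a large
   constant k.  The trace is a sum over chains of 2k walks.  Since A - Abar is
   centred, only chains that cover twice every hyperedge seen exclusively through
   centred factors contribute, and the contribution of a chain is at most the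
   probability that all its hyperedges are present.  Explore a chain step by step.
   A fresh hyperedge (all its vertices but the current one are unseen) contributes
   at most alpha after summation, and fresh hyperedges form a forest, so that a
   stretch of already seen fresh hyperedges is an ascent followed by a descent and
   is determined by its end points.  A new hyperedge that meets seen vertices (a
   collision) gains 1/n, and the number of changes of regime is at most linear in
   the number of collisions; each change costs a power of log n.  Hence
   E tr (M^T M)^k <= n^(1-g) (log n)^O(1) alpha^(number of hyperedges) where g bounds
   the number of collisions from below: g = 0 for Delta, and g = 2k for Gamma because
   a concatenation that is not self-avoiding forces a collision. *)

Require Import Defs.
From HB Require Import structures.
From mathcomp Require Import all_boot all_order all_algebra.
From mathcomp Require Import all_classical all_reals all_analysis.
From mathcomp Require Import fintype finset zify ring lra.
Import Order.TTheory GRing.Theory Num.Theory.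
Import numFieldNormedType.Exports.
Set Implicit Arguments. Unset Strict Implicit. Unset Printing Implicit Defensive.
Local Open Scope ring_scope.

(** * Walks in the complete hypergraph *)

(** A chain cannot be summed step by step as it stands: a descent in the forest of fresh hyperedges
    branches, and each child has weight one. The sum is therefore weighted by a potential that
    counts the vertices below the current one and that its children share; only the entry into a
    descent has to pay for it. Let L, a multiple of the walk length, bound both the number of steps
    and the number of seen vertices, so that this price is at most L^2. Each change of regime is
    discounted by [theta], of order L^-3; then one step multiplies the weighted sum by at most 1 +
    1/L, and the whole chain costs a factor e. The discounts are repaid by Theta = 1/theta, a power
    of log n, once per change; J restarts and G collisions allow at most (4 + 4J) + (8 + 4J)G
    changes. Since Theta^(8 + 4J) <= n eventually, extra collisions only lower the bound, which is
    why a lower bound on their number suffices. The exponent k satisfies 2k eps >= 2: one factor n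
    absorbs the number of starting points of the trace, the other makes Markov's bound O(1/n) up to
    logarithms, enough for a union over m. *)

Section TupleSums.
Variables (R : nmodType) (X : finType).

Lemma big_tuple0 (F : seq X -> R) : \sum_(w : 0.-tuple X) F w = F [::].
Proof.
rewrite (bigD1 [tuple of [::]]) //= big1 ?addr0 // => w /eqP[].
exact: tuple0.
Qed.

Lemma big_tupleS L (F : seq X -> R) :
  \sum_(w : L.+1.-tuple X) F w = \sum_(x : X) \sum_(w : L.-tuple X) F (x :: w).
Proof.
rewrite pair_big /=.
rewrite (reindex (fun p : X * L.-tuple X => cons_tuple p.1 p.2)) //=.
exists (fun w : L.+1.-tuple X => (thead w, [tuple of behead w])) => /=.
  by case=> x w _ /=; rewrite theadE; congr pair; apply: val_inj.
by move=> w _; rewrite [w in RHS]tuple_eta; apply: val_inj.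
Qed.

Lemma big_tuple_cat L1 L2 (F : seq X -> R) :
  \sum_(w : (L1 + L2).-tuple X) F w =
  \sum_(u : L1.-tuple X) \sum_(v : L2.-tuple X) F (u ++ v).
Proof.
elim: L1 F => [|L1 IH] F.
  by rewrite (big_tuple0 (fun u => \sum_(v : L2.-tuple X) F (u ++ v))).
rewrite addSn big_tupleS (big_tupleS _ (fun u => \sum_(v : L2.-tuple X) F (u ++ v))).
by apply: eq_bigr => x _; exact: (IH (fun w => F (x :: w))).
Qed.
End TupleSums.

Section Walks.
Variables (n d : nat).
Notation X := ({set 'I_n} * 'I_n)%type.
Implicit Types (i j : 'I_n) (w u v : seq X) (x : X).

Definition lst i w : 'I_n := last i (unzip2 w).

(** The start is not moved along the recursion; a legal first hop absorbs it ([wvis_cons]). *)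
Fixpoint wvis i w : {set 'I_n} :=
  if w is x :: w' then x.1 :|: wvis i w' else [set i].

Definition hop i x : bool :=
  [&& #|x.1| == d, i != x.2, i \in x.1 & x.2 \in x.1].

(** Recursive self-avoidance: asking that the first hyperedge meets all that follows only in the
    next vertex replaces the distinctness, adjacency and disjointness clauses of [is_saw]. *)
Fixpoint saw i w : bool :=
  if w is x :: w' then
    [&& hop i x, saw x.2 w' & x.1 :&: wvis x.2 w' == [set x.2]]
  else true.

(** The reversed walk, to be read from the last vertex [lst i w]. *)
Fixpoint rw i w : seq X :=
  if w is x :: w' then rcons (rw x.2 w') (x.1, i) else [::].

Lemma lst_cat i u v : lst i (u ++ v) = lst (lst i u) v.
Proof. by rewrite /lst /unzip2 map_cat last_cat. Qed.

Lemma lst_cons i x w : lst i (x :: w) = lst x.2 w.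
Proof. by []. Qed.

Lemma mem_wvis z i w : (z \in wvis i w) = (z == i) || has (fun x => z \in x.1) w.
Proof.
elim: w => [|x w IH] /=; first by rewrite inE orbF.
by rewrite inE IH orbCA.
Qed.

Lemma wvis_start i w : i \in wvis i w.
Proof. by rewrite mem_wvis eqxx. Qed.

Lemma wvis_cons i x w : hop i x -> wvis i (x :: w) = x.1 :|: wvis x.2 w.
Proof.
case/and4P=> _ _ ix yx; apply/setP=> z; rewrite !(inE, mem_wvis) /=.
case zx: (z \in x.1) => //=; first by rewrite !orbT.
have [zi|_] := z =P i; first by rewrite -zi zx in ix.
by have [zi|_] := z =P x.2; first by rewrite -zi zx in yx.
Qed.

Lemma wvis_cat i u v : saw i u -> wvis i (u ++ v) = wvis i u :|: wvis (lst i u) v.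
Proof.
elim: u i => [|x u IH] i /=.
  by move=> _; apply/setP=> z; rewrite !(inE, mem_wvis); case: (z == i).
case/and3P=> hx su _; have := IH _ su.
rewrite -[x.1 :|: wvis i (u ++ v)]/(wvis i (x :: (u ++ v))).
rewrite -[x.1 :|: wvis i u]/(wvis i (x :: u)) !wvis_cons // => ->.
by rewrite setUA.
Qed.

Lemma lst_wvis i w : saw i w -> lst i w \in wvis i w.
Proof. by move=> s; rewrite -[w]cats0 wvis_cat // cats0 !inE eqxx orbT. Qed.

(** Induction on [u]. Let E be the first hyperedge and A, B the vertices of the rest of [u] and of
    [v]. Either bracketing puts the pairwise intersections into the two junctions, and a point of E
    and B outside A is excluded because both junctions lie in A. *)
Lemma saw_cat i u v :
  saw i (u ++ v) =
  [&& saw i u, saw (lst i u) v & wvis i u :&: wvis (lst i u) v == [set lst i u]].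
Proof.
elim: u i => [|x u IH] i.
  rewrite /= [X in _ && X](_ : _ = true) ?andbT //.
  by apply/eqP/setP=> z; rewrite !inE andb_idr // => /eqP->; exact: wvis_start.
rewrite cat_cons /= IH lst_cons.
case hx: (hop i x) => //=; case su: (saw x.2 u) => //=.
case sv: (saw (lst x.2 u) v) => /=; last by rewrite andbF.
rewrite wvis_cat // -[x.1 :|: wvis i u]/(wvis i (x :: u)) wvis_cons //.
set A := wvis x.2 u; set B := wvis _ v; set l := lst x.2 u; set E := x.1.
have yE : x.2 \in E by case/and4P: hx.
have yA : x.2 \in A by exact: wvis_start.
have lA : l \in A by exact: lst_wvis.
have lB : l \in B by exact: wvis_start.
apply/andP/andP => [[/eqP/setP hAB /eqP/setP hE]|[/eqP/setP hE /eqP/setP hB]].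
- split; apply/eqP/setP=> z; have := hE z; have := hAB z; rewrite !inE.
    case zE: (z \in E); case zA: (z \in A); case zB: (z \in B) => //= h1 h2.
    by move: zA; rewrite (eqP (esym h2)) yA.
  case zE: (z \in E); case zA: (z \in A); case zB: (z \in B) => //= h1 h2.
  by move: zA; rewrite (eqP (esym h2)) yA.
- split; apply/eqP/setP=> z; have := hE z; have := hB z; rewrite !inE.
    case zE: (z \in E); case zA: (z \in A); case zB: (z \in B) => //= h1 h2.
    by move: zA; rewrite (eqP (esym h1)) lA.
  case zE: (z \in E); case zA: (z \in A); case zB: (z \in B) => //= h1 h2.
  by move: zA; rewrite (eqP (esym h1)) lA.
Qed.

Lemma lst_rw i j w : lst i w = j -> lst j (rw i w) = i.
Proof.
case: w => [|x w] /=; first by [].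
by move=> _; rewrite /lst /unzip2 map_rcons last_rcons.
Qed.

Lemma size_rw i w : size (rw i w) = size w.
Proof. by elim: w i => //= x w IH i; rewrite size_rcons IH. Qed.

Lemma unzip1_rw i w : unzip1 (rw i w) = rev (unzip1 w).
Proof. by elim: w i => //= x w IH i; rewrite /unzip1 map_rcons [map _ _]IH rev_cons. Qed.

Lemma rw_cat i u v : rw i (u ++ v) = rw (lst i u) v ++ rw i u.
Proof.
elim: u i => [|x u IH] i /=; first by rewrite cats0.
by rewrite IH lst_cons rcons_cat.
Qed.

Lemma rwK i j w : lst i w = j -> rw j (rw i w) = w.
Proof.
elim: w i => //= x w IH i; rewrite lst_cons => hj.
by rewrite -cats1 rw_cat /= (lst_rw hj) IH //; case: x {hj}.
Qed.

Lemma wvis_rw i j w : saw i w -> lst i w = j -> wvis j (rw i w) = wvis i w.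
Proof.
move=> sw hj; apply/setP => z; rewrite !mem_wvis.
have -> : has (fun x => z \in x.1) (rw i w) = has (fun x => z \in x.1) w.
  rewrite -!(has_map fst (fun e : {set 'I_n} => z \in e)).
  by rewrite -/(unzip1 _) -/(unzip1 _) unzip1_rw has_rev.
apply/orP/orP => -[|->]; [|by right| |by right].
  by move/eqP->; move: (lst_wvis sw); rewrite hj mem_wvis => /orP.
move/eqP->; case: w sw hj => [|x w] /=; first by move=> _ <-; left.
by case/andP=> /and4P [_ _ -> _] _ _; right.
Qed.

Lemma hop_sym i x : hop i x = hop x.2 (x.1, i).
Proof. by rewrite /hop /= [i == _]eq_sym [in LHS](andbC (i \in _)). Qed.

Lemma saw_rw i j w : lst i w = j -> saw j (rw i w) = saw i w.
Proof.
have aux k v : saw k v -> saw (lst k v) (rw k v).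
  elim: v k => [|x v IH] k //= /and3P [hx sv /eqP hE].
  rewrite lst_cons -cats1 saw_cat IH //= (lst_rw (erefl _)) -hop_sym hx /=.
  rewrite (wvis_rw sv (erefl _)).
  have yE : x.2 \in x.1 by case/and4P: hx.
  have kE : k \in x.1 by case/and4P: hx.
  rewrite -{2}hE setIC; apply/andP; split; apply/eqP/setP=> z; rewrite !inE.
    by have [->|_] := z =P k; rewrite ?kE.
  have [->|_] := z =P x.2; first by rewrite yE wvis_start.
  by rewrite orbF andbC.
move=> hj; apply/idP/idP => sw; last by rewrite -hj; exact: aux.
by have := aux _ _ sw; rewrite (lst_rw hj) (rwK hj).
Qed.
Definition vtx i w t : 'I_n := nth i (i :: unzip2 w) t.

Lemma vtxS i x w t : (t <= size w)%N -> vtx i (x :: w) t.+1 = vtx x.2 w t.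
Proof. by move=> tw; rewrite /vtx /=; apply: set_nth_default; rewrite /= size_map. Qed.

(** The indexed form matches the clauses of [is_saw] one by one; distinctness of the vertices is
    absent since it follows ([saw_uniq]). *)
Lemma sawP i w :
  let E t := nth (finset.set0 : {set 'I_n}) (unzip1 w) t in
  reflect [/\ forall t, (t < size w)%N -> hop (vtx i w t) (E t, vtx i w t.+1),
              forall t, (t.+1 < size w)%N -> E t :&: E t.+1 = [set vtx i w t.+1] &
              forall t k, (t.+2 <= k)%N -> (k < size w)%N -> E t :&: E k = finset.set0]
          (saw i w).
Proof.
elim: w i => [|x w IH] i E; first by apply: ReflectT; split.
apply: (iffP idP) => /=.
- case/and3P => hx /IH [h1 h2 h3] /eqP/setP hE.
  have yE : x.2 \in x.1 by case/and4P: hx.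
  have EW k : (k < size w)%N -> {subset E k.+1 <= wvis x.2 w}.
    move=> kw z zE; rewrite mem_wvis; apply/orP; right.
    apply/hasP; exists (nth (finset.set0, i) w k); first exact: mem_nth.
    by rewrite /E /= (nth_map (finset.set0, i)) in zE.
  split.
  + case=> [_|t tw]; first by move: hx; rewrite /vtx /E /=; case: (x).
    by rewrite !vtxS //; [exact: h1 | exact: ltnW].
  + case=> [w0|t tw]; last by rewrite vtxS; [exact: h2 | exact: ltnW].
    have /and4P [_ _ y1 _] := h1 0%N w0.
    apply/setP => z; have := hE z; rewrite /vtx /= !inE => {}hE.
    apply/andP/eqP => [[zx z1]|->]; last by split.
    by apply/eqP; rewrite -hE zx (EW 0%N).
  + move=> [|t] [|k] //; last by rewrite !ltnS => tk kw; exact: h3.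
    rewrite !ltnS => k0 kw; apply/setP => z; have := hE z.
    rewrite !inE => {}hE; apply/negP => /andP [zx zk].
    have zy : z = x.2 by apply/eqP; rewrite -hE zx (EW k).
    have w0 : (0 < size w)%N by apply: leq_ltn_trans kw.
    have /and4P [_ yn y1 _] := h1 0%N w0.
    case: k k0 kw zk => // -[|k] _ kw zk.
      have /setP/(_ z) := h2 0%N kw; rewrite !inE zy.
      by rewrite -{2}zy zk andbT y1 => /esym; rewrite (negbTE yn).
    have /setP/(_ z) := h3 0%N k.+2 isT kw; rewrite !inE.
    by rewrite {1}zy -[X in _ && X]/(z \in E k.+3) zk y1.
- case=> h1 h2 h3.
  have hx : hop i x by have := h1 0%N isT; rewrite /vtx /E /=; case: (x).
  have yE : x.2 \in x.1 by case/and4P: hx.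
  rewrite hx /=; apply/andP; split.
    apply/IH; split => [t tw|t tw|t k tk kw].
    + by have := h1 t.+1 tw; rewrite !vtxS //; exact: ltnW.
    + by have := h2 t.+1 tw; rewrite vtxS //; exact: ltnW.
    + by have := h3 t.+1 k.+1 tk kw.
  apply/eqP/setP => z; rewrite !inE mem_wvis.
  apply/andP/eqP => [[zx]|->]; last by rewrite eqxx.
  case/orP=> [/eqP //|/(has_nthP (finset.set0, i)) [k kw zk]].
  have zE : z \in E k.+1 by rewrite /E /= (nth_map (finset.set0, i)).
  case: k kw zk zE => [|k] kw zk zE.
    by have /setP/(_ z) := h2 0%N kw; rewrite !inE zx zE /= => /esym/eqP.
  by have /setP/(_ z) := h3 0%N k.+2 isT kw; rewrite !inE zx zE.
Qed.

Lemma saw_unzip2 i w : saw i w -> {subset unzip2 w <= wvis i w}.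
Proof.
elim: w i => [|x w IH] i //= /and3P [hx sw _] z.
rewrite -[x.1 :|: _]/(wvis i (x :: w)) wvis_cons // !inE => /orP [/eqP->|].
  by rewrite wvis_start orbT.
by move/(IH _ sw)->; rewrite orbT.
Qed.

Lemma saw_uniq i w : saw i w -> uniq (i :: unzip2 w).
Proof.
elim: w i => [|x w IH] i //= /and3P [hx sw /eqP/setP hE].
have /= -> := IH _ sw; rewrite andbT inE negb_or.
have /and4P [_ ny ix _] := hx.
rewrite ny; apply/negP => /(saw_unzip2 sw) iw.
by have := hE i; rewrite !inE ix iw (negbTE ny).
Qed.

Lemma is_sawE l i j (w : l.-tuple X) (vs : l.+1.-tuple 'I_n)
    (es : l.-tuple {set 'I_n}) :
  tval vs = i :: unzip2 w -> tval es = unzip1 w ->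
  is_saw d i j vs es = saw i w && (lst i w == j).
Proof.
move=> evs ees; rewrite /is_saw.
have vE k : nth i vs k = vtx i w k by rewrite evs.
have szw := size_tuple w.
have vl : vtx i w l = lst i w.
  rewrite /vtx /lst -[X in nth _ _ X]szw.
  by rewrite (last_nth i) size_map.
apply/and5P/andP.
- case=> _ vlj un /forallP h1 /andP [/forallP h2 /forallP h3].
  move: vlj; rewrite vE vl => ->; split=> //; apply/sawP; split.
  + move=> t; rewrite szw => tl; have /= := h1 (Ordinal (n:=l.+1) (m:=t.+1) tl).
    by rewrite !vE ees /hop /= => /and4P [-> -> -> ->].
  + move=> t; rewrite szw => tl; have /= := h2 (Ordinal (n:=l.+1) (m:=t.+2) tl).
    by rewrite vE ees /= => /eqP.
  + move=> t k tk; rewrite szw => kl.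
    have tl : (t < l)%N := ltn_trans (ltnW tk) kl.
    have /forallP := h3 (Ordinal (n:=l.+1) (m:=t.+1) tl).
    move=> /(_ (Ordinal (n:=l.+1) (m:=k.+1) kl)) /=.
    by rewrite ltnS tk ees => /eqP.
- case=> sw lj; have /sawP [h1 h2 h3] := sw.
  rewrite szw in h1 h2 h3.
  split; rewrite ?vE //; first by rewrite vl.
    by rewrite evs; exact: saw_uniq.
    apply/forallP => -[[|t] /= tl] //; rewrite !vE ees.
    by have /and4P [-> -> -> ->] := h1 t tl.
  apply/andP; split.
    apply/forallP => -[[|[|t]] /= tl] //; rewrite vE ees.
    by rewrite (h2 t tl).
  apply/forallP => -[[|t] /= tl]; apply/forallP => -[[|k] /= kl] //.
  by rewrite ees ltnS; apply/implyP => tk; rewrite (h3 t k tk kl).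
Qed.

Lemma big_is_saw (R : nmodType) l i j (F : seq 'I_n -> seq {set 'I_n} -> R) :
  \sum_(vs : (l.+1).-tuple 'I_n) \sum_(es : l.-tuple {set 'I_n} | is_saw d i j vs es)
     F vs es =
  \sum_(w : l.-tuple X | saw i w && (lst i w == j)) F (i :: unzip2 w) (unzip1 w).
Proof.
rewrite pair_big_dep /=.
pose h (w : l.-tuple X) : l.+1.-tuple 'I_n * l.-tuple {set 'I_n} :=
  ([tuple of i :: unzip2 w], [tuple of unzip1 w]).
pose h' (p : l.+1.-tuple 'I_n * l.-tuple {set 'I_n}) : l.-tuple X :=
  zip_tuple p.2 (behead_tuple p.1).
have hK (w : l.-tuple X) : h' (h w) = w.
  by apply: val_inj; rewrite /= zip_unzip.
rewrite (reindex_onto h h') /=.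
  apply: eq_bigl => w; rewrite hK eqxx andbT.
  exact: is_sawE.
case=> vs es /= /and5P [v0 _ _ _ _]; rewrite /h /h' /=; congr pair; apply: val_inj => /=.
  rewrite unzip2_zip ?size_tuple // -{1}(eqP v0).
  by case: (vs) => -[].
by rewrite unzip1_zip ?size_tuple.
Qed.
End Walks.

(** * Matrices indexed by walks *)

Section PathMatrices.
Variables (R : realType) (n : nat).
Notation X := ({set 'I_n} * 'I_n)%type.
Implicit Types (i j : 'I_n) (w u v : seq X) (x : X) (g : 'I_n -> seq X -> R).

Definition pmat L g : 'M[R]_n :=
  \matrix_(i, j) \sum_(w : L.-tuple X) (lst i w == j)%:R * g i w.

Lemma eq_pmat L g1 g2 :
  (forall i w, size w = L -> g1 i w = g2 i w) -> pmat L g1 = pmat L g2.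
Proof.
move=> eqg; apply/matrixP => i j; rewrite !mxE.
by apply: eq_bigr => w _; rewrite eqg // size_tuple.
Qed.

Lemma pmatD L g1 g2 : pmat L (fun i w => g1 i w + g2 i w) = pmat L g1 + pmat L g2.
Proof.
by apply/matrixP => i j; rewrite !mxE -big_split /=; apply: eq_bigr => w _; rewrite mulrDr.
Qed.

Lemma pmatB L g1 g2 : pmat L (fun i w => g1 i w - g2 i w) = pmat L g1 - pmat L g2.
Proof.
by apply/matrixP => i j; rewrite !mxE -sumrB; apply: eq_bigr => w _; rewrite mulrBr.
Qed.

Lemma pmat_sum L (I : Type) (r : seq I) (P : pred I) (G : I -> 'I_n -> seq X -> R) :
  pmat L (fun i w => \sum_(k <- r | P k) G k i w) = \sum_(k <- r | P k) pmat L (G k).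
Proof.
apply/matrixP => i j; rewrite summxE mxE.
under [RHS]eq_bigr do rewrite mxE.
by rewrite exchange_big /=; apply: eq_bigr => w _; rewrite mulr_sumr.
Qed.

Lemma pmat_mul L1 L2 g1 g2 :
  pmat L1 g1 *m pmat L2 g2 =
  pmat (L1 + L2) (fun i w => g1 i (take L1 w) * g2 (lst i (take L1 w)) (drop L1 w)).
Proof.
apply/matrixP => i j; rewrite !mxE.
rewrite (big_tuple_cat _ _ (fun w => (lst i w == j)%:R *
  (g1 i (take L1 w) * g2 (lst i (take L1 w)) (drop L1 w)))) /=.
under eq_bigr => k _ do rewrite !mxE mulr_suml.
rewrite exchange_big /=; apply: eq_bigr => u _.
rewrite (bigD1 (lst i u)) //= eqxx mul1r [X in _ + X]big1 ?addr0; last first.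
  by move=> k; rewrite eq_sym => /negbTE ->; rewrite mul0r mul0r.
rewrite mulr_sumr; apply: eq_bigr => v _.
by rewrite lst_cat take_size_cat ?drop_size_cat ?size_tuple // mulrCA.
Qed.

Lemma pmat_tr L g g' :
  (forall i j w, size w = L -> lst i w = j -> g' j (rw i w) = g i w) ->
  (pmat L g)^T = pmat L g'.
Proof.
move=> gE; apply/matrixP => j i; rewrite !mxE.
have szr k (w : L.-tuple X) : size (rw k w) == L by rewrite size_rw size_tuple.
pose rt k (w : L.-tuple X) : L.-tuple X := Tuple (szr k w).
have condE k l G : \sum_(w : L.-tuple X) (lst k w == l)%:R * G k (tval w) =
    \sum_(w : L.-tuple X | lst k w == l) G k (tval w) :> R.
  by rewrite [RHS]big_mkcond /=; apply: eq_bigr => w _; case: eqP; rewrite ?mul1r ?mul0r.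
rewrite !condE (reindex_onto (rt j) (rt i)) /=; last first.
  by move=> w /eqP lw; apply: val_inj; rewrite /= (rwK lw).
apply: eq_big => [w|w /andP [/eqP lw /eqP wE]].
  apply/andP/eqP => [[/eqP lw /eqP wE]|lw].
    by rewrite -wE /= (lst_rw lw).
  by split; apply/eqP; [exact: lst_rw | apply: val_inj; rewrite /= (rwK lw)].
have lj : lst j w = i by rewrite -wE /= (lst_rw lw).
by rewrite -(gE i j (rw j w)) ?size_rw ?size_tuple // (rwK lj).
Qed.
End PathMatrices.

(* The factor attached to a step with hyperedge e: Some true is A^e - Abar^e,
   Some false is A^e, None is Abar^e. *)
Definition kind := option bool.
Notation cen := (Some true : kind).
Notation non := (Some false : kind).
Notation bri := (None : kind).

(* The flag marks the beginning of a walk after a restart. *)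
Definition instr := (kind * bool)%type.

(** * Matrices with prescribed factors, and the decomposition of B *)

Section Copies.
Variables (R : realType) (n d : nat) (a b : R).
Notation X := ({set 'I_n} * 'I_n)%type.
Implicit Types (i j : 'I_n) (w u v : seq X) (x : X) (s : spins n) (H : hgraph n).

Definition fac s H (k : kind) (e : {set 'I_n}) : R :=
  match k with
  | Some true => (e \in H)%:R - edge_prob d a b s e
  | Some false => (e \in H)%:R
  | None => edge_prob d a b s e
  end.

Definition gpr s H (ks : seq kind) (es : seq {set 'I_n}) : R :=
  \prod_(p <- zip ks es) fac s H p.1 p.2.

(** A factor sequence with a set of admissible words. Such matrices are closed under products, so
    one trace estimate serves both Delta and Gamma. *)
Record copy := Copy { cprog : seq instr; cval : 'I_n -> seq X -> bool }.

Definition ckinds c := unzip1 (cprog c).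

Definition csize c := size (cprog c).

Definition mcopy s H c : 'M[R]_n :=
  pmat (csize c) (fun i w => (cval c i w)%:R * gpr s H (ckinds c) (unzip1 w)).

Definition cat_copy c1 c2 :=
  Copy (cprog c1 ++ cprog c2)
       (fun i w => cval c1 i (take (csize c1) w) &&
                   cval c2 (lst i (take (csize c1) w)) (drop (csize c1) w)).

Definition nil_copy := Copy [::] (fun _ _ => true).

Definition mkprog (ks : seq kind) : seq instr :=
  if ks is k :: ks' then (k, true) :: [seq (k, false) | k <- ks'] else [::].

Definition walk_copy (k : kind) l := Copy (mkprog (nseq l k)) (saw d).

(** The words of a product of a walk matrix, [Abar] and another walk matrix: each piece is legal,
    with no condition between the pieces. *)
Definition bridged p i w :=
  saw d i (take p w) &&
  (if drop p w is x :: v then hop d (lst i (take p w)) x && saw d x.2 v else false).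

(* With ka = cen, p = l - m, kb = non, q = m - 1 this is Gamma^(l,m).  The second
   walk carries no restart flag: whether the vertex reached by the bridge is new
   must be remembered. *)
Definition gap_copy ka p kb q :=
  Copy (mkprog (nseq p ka) ++ (bri, true) :: [seq (k, false) | k <- nseq q kb])
       (fun i w => bridged p i w && ~~ saw d i w).

Lemma mkprogE ks : unzip1 (mkprog ks) = ks.
Proof. by case: ks => //= k ks; rewrite /unzip1 -map_comp map_id. Qed.

Lemma unzip1_pairf (ks : seq kind) : unzip1 [seq (k, false) | k <- ks] = ks.
Proof. by rewrite /unzip1 -map_comp map_id. Qed.

Lemma size_mkprog ks : size (mkprog ks) = size ks.
Proof. by rewrite -[in RHS](mkprogE ks) size_map. Qed.

Lemma gpr_cat s H ks1 ks2 es1 es2 : size ks1 = size es1 ->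
  gpr s H (ks1 ++ ks2) (es1 ++ es2) = gpr s H ks1 es1 * gpr s H ks2 es2.
Proof. by move=> sz; rewrite /gpr zip_cat // big_cat. Qed.

Lemma gpr_rev s H ks es : size ks = size es ->
  gpr s H (rev ks) (rev es) = gpr s H ks es.
Proof. by move=> sz; rewrite /gpr -rev_zip // big_rev. Qed.

Lemma mcopy_cat s H c1 c2 :
  mcopy s H (cat_copy c1 c2) = mcopy s H c1 *m mcopy s H c2.
Proof.
rewrite /mcopy pmat_mul /csize size_cat.
apply: eq_pmat => i w sw /=.
have -> : ckinds (cat_copy c1 c2) = ckinds c1 ++ ckinds c2.
  by rewrite /ckinds /unzip1 map_cat.
have -> : unzip1 w = unzip1 (take (size (cprog c1)) w) ++ unzip1 (drop (size (cprog c1)) w).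
  by rewrite /unzip1 -map_cat cat_take_drop.
rewrite gpr_cat; last first.
  by rewrite /ckinds /unzip1 !size_map size_takel // sw leq_addr.
by rewrite -mulnb natrM mulrACA.
Qed.

Lemma mcopy_nil s H : mcopy s H nil_copy = 1%:M.
Proof.
apply/matrixP => i j; rewrite !mxE.
rewrite (big_tuple0 (fun w => (lst i w == j)%:R * (true%:R * gpr s H [::] (unzip1 w)))).
by rewrite /gpr big_nil !mulr1 /lst /=.
Qed.

Lemma gpr_nseq s H k es :
  gpr s H (nseq (size es) k) es = \prod_(e <- es) fac s H k e.
Proof. by rewrite /gpr; elim: es => [|e es IH] /=; rewrite ?big_nil // !big_cons IH. Qed.

Lemma walk_copyE s H k l (G : {set 'I_n} -> 'I_n -> 'I_n -> R) i j :
  (forall i x, hop d i x -> G x.1 i x.2 = fac s H k x.1) ->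
  \sum_(vs : (l.+1).-tuple 'I_n) \sum_(es : l.-tuple {set 'I_n} | is_saw d i j vs es)
    \prod_(t < l) G (nth (finset.set0 : {set 'I_n}) es t) (nth i vs t) (nth i vs t.+1)
  = mcopy s H (walk_copy k l) i j.
Proof.
move=> GE.
rewrite (big_is_saw d l i j (fun vs es => \prod_(t < l)
  G (nth (finset.set0 : {set 'I_n}) es t) (nth i vs t) (nth i vs t.+1))).
rewrite mxE /csize /= size_mkprog size_nseq big_mkcond /=.
apply: eq_bigr => w _; rewrite /ckinds /= mkprogE andbC.
case: eqP => _; rewrite ?mul0r ?mul1r //=.
case: (boolP (saw d i w)) => [/sawP [h1 _ _]|_]; rewrite ?mul0r ?mul1r //=.
have -> : gpr s H (nseq l k) (unzip1 w) = \prod_(e <- unzip1 w) fac s H k e.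
  by rewrite -gpr_nseq size_map size_tuple.
rewrite (big_nth finset.set0) big_mkord size_map size_tuple.
by apply: eq_bigr => t _; rewrite -(GE _ _ (h1 t _)) // size_tuple.
Qed.

Lemma Delta_mcopy s H l : Delta d a b s H l = mcopy s H (walk_copy cen l).
Proof.
apply/matrixP => i j; rewrite mxE.
apply: (@walk_copyE s H cen l (fun e i j => Ae H e i j - Abare d a b s e i j)).
by move=> {}i x /and4P [_ h1 h2 h3]; rewrite /Ae /Abare h1 h2 h3 /= mul1r.
Qed.

Lemma Bmat_mcopy s H l : Bmat d H l = mcopy s H (walk_copy non l).
Proof.
apply/matrixP => i j; rewrite mxE.
apply: (@walk_copyE s H non l (fun e i j => Ae H e i j)).
by move=> {}i x /and4P [_ h1 h2 h3]; rewrite /Ae h1 h2 h3.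
Qed.

Definition bridge_copy :=
  Copy [:: (bri, true)] (fun i w => if w is [:: x] then hop d i x else false).

Lemma Abar_mcopy s H : Abar d a b s = mcopy s H bridge_copy.
Proof.
apply/matrixP => i j; rewrite !mxE.
pose F w := (lst i w == j)%:R *
  ((cval bridge_copy i w)%:R * gpr s H (ckinds bridge_copy) (unzip1 w)).
rewrite (big_tupleS _ F).
under [RHS]eq_bigr => x _ do rewrite (big_tuple0 (fun w => F (x :: w))).
transitivity (\sum_e \sum_y F [:: (e, y)]); last first.
  by rewrite pair_big; apply: eq_bigr => -[].
rewrite big_mkcond; apply: eq_bigr => e _; rewrite /F /lst /=.
rewrite (bigD1 j) //= eqxx mul1r big1 ?addr0; last first.
  by move=> y /negbTE ->; rewrite mul0r.
rewrite /gpr /= big_cons big_nil mulr1 /hop /Abare /= inE.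
by case: (#|e| == d); rewrite ?mul0r //= -andbA.
Qed.

Definition cat3 ka p kb q := cat_copy (walk_copy ka p) (cat_copy bridge_copy (walk_copy kb q)).

Lemma cat3E s H ka p kb q :
  mcopy s H (cat3 ka p kb q) =
  pmat (p + q.+1) (fun i w => (bridged p i w)%:R *
                     gpr s H (nseq p ka ++ bri :: nseq q kb) (unzip1 w)).
Proof.
rewrite /mcopy /csize /= size_cat /= !size_mkprog !size_nseq.
apply: eq_pmat => i w sw; congr (_%:R * gpr _ _ _ _).
  rewrite /= /csize /bridged size_mkprog size_nseq; congr (_ && _).
  case: (drop p w) => [|x v] //=; rewrite take0 drop0.
  by rewrite /lst.
by rewrite /ckinds /= /unzip1 map_cat /= -!/(unzip1 _) !mkprogE.
Qed.

Lemma mcopy_gapE s H ka p kb q :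
  mcopy s H (gap_copy ka p kb q) =
  pmat (p + q.+1) (fun i w => (bridged p i w && ~~ saw d i w)%:R *
                     gpr s H (nseq p ka ++ bri :: nseq q kb) (unzip1 w)).
Proof.
rewrite /mcopy /csize /= size_cat /= size_mkprog size_map !size_nseq.
apply: eq_pmat => i w sw; congr (_%:R * gpr _ _ _ _).
by rewrite /ckinds /= /unzip1 map_cat /= -!/(unzip1 _) mkprogE unzip1_pairf.
Qed.

Lemma saw_bridged p i w : (p < size w)%N -> saw d i w -> bridged p i w.
Proof.
move=> pw; rewrite -{1}[w](cat_take_drop p) saw_cat /bridged => /and3P [-> + _].
case E: (drop p w) => [|x v] /=.
  by move: (size_drop p w); rewrite E /=; lia.
by case/and3P=> -> ->.
Qed.

(** The first factor is split as centred part plus mean. The mean gives the new term of largest [m];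
    the centred part is prefixed to the expansion of the rest. *)
Lemma telescope s H es :
  gpr s H (nseq (size es) non) es =
  gpr s H (nseq (size es) cen) es +
  \sum_(1 <= m < (size es).+1) gpr s H (nseq (size es - m) cen ++ bri :: nseq m.-1 non) es.
Proof.
elim: es => [|e es IH]; first by rewrite big_geq // addr0.
rewrite [size (e :: es)]/= big_nat_recr //= subnn /=.
rewrite /gpr !big_cons -!/(gpr s H _ es) /=.
set c := _ - edge_prob d a b s e.
have -> : (e \in H)%:R = c + edge_prob d a b s e by rewrite /c subrK.
rewrite mulrDl {1}IH mulrDr -addrA; congr (_ + (_ + _)).
rewrite mulr_sumr !big_nat; apply: eq_bigr => m /andP [m1 ml].
by rewrite subSn //= big_cons.
Qed.

(** Telescoping yields sums over [saw] words, whereas the matrix products run over [bridged] words;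
    the difference is exactly the set of words of [gap_copy]. *)
Theorem Bmat_decomposition s H l : (1 <= l)%N ->
  Bmat d H l = Delta d a b s H l
   + \sum_(1 <= m < l.+1) (Delta d a b s H (l - m) *m Abar d a b s *m Bmat d H m.-1)
   - \sum_(1 <= m < l.+1) mcopy s H (gap_copy cen (l - m) non m.-1).
Proof.
move=> l1; rewrite -addrA -sumrB.
pose G m i w := (saw d i w)%:R * gpr s H (nseq (l - m) cen ++ bri :: nseq m.-1 non) (unzip1 w).
transitivity (Delta d a b s H l + \sum_(1 <= m < l.+1) pmat l (G m)); last first.
  congr (_ + _); rewrite !big_nat; apply: eq_bigr => m /andP [m1 ml].
  rewrite Delta_mcopy (Bmat_mcopy s) (Abar_mcopy _ H) -mulmxA -!mcopy_cat -/(cat3 _ _ _ _).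
  rewrite cat3E mcopy_gapE (_ : (l - m + m.-1.+1)%N = l); last by lia.
  rewrite -pmatB; apply: eq_pmat => i w sw; rewrite /G -mulrBl; congr (_ * _).
  case: (boolP (saw d i w)) => sa; rewrite ?andbF ?andbT ?subrr // subr0.
  by rewrite saw_bridged // sw; lia.
rewrite (Bmat_mcopy s) Delta_mcopy /mcopy /csize /= !size_mkprog !size_nseq.
rewrite -pmat_sum -pmatD; apply: eq_pmat => i w sw.
rewrite /G /ckinds /= !mkprogE -mulr_sumr -mulrDr; congr (_ * _).
by have := telescope s H (unzip1 w); rewrite size_map sw.
Qed.

Lemma mcopy_walk_tr s H k l :
  (mcopy s H (walk_copy k l))^T = mcopy s H (walk_copy k l).
Proof.
rewrite /mcopy; apply: pmat_tr => i j w; rewrite /csize /= size_mkprog size_nseq => sw lw.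
rewrite (saw_rw d lw) unzip1_rw; congr (_ * _).
rewrite -[in RHS]gpr_rev; last by rewrite /ckinds /= mkprogE size_nseq size_map.
by rewrite /ckinds /= mkprogE rev_nseq.
Qed.

(** Reversal exchanges the two walks, which makes M^T M a product of copies. The restart flags are
    not reversed, but the matrix depends on the kinds alone. *)
Lemma mcopy_gap_tr s H ka p kb q :
  (mcopy s H (gap_copy ka p kb q))^T = mcopy s H (gap_copy kb q ka p).
Proof.
rewrite /mcopy.
have szE : csize (gap_copy kb q ka p) = csize (gap_copy ka p kb q).
  by rewrite /csize /= !size_cat /= !size_mkprog !size_map !size_nseq; lia.
rewrite szE; apply: pmat_tr => i j w; rewrite /csize /= size_cat /= size_mkprog.
rewrite size_map !size_nseq => sw lw.
have [u [x [v [wE su sv]]]] : exists u x v, [/\ w = u ++ x :: v, size u = p & size v = q].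
  case E: (drop p w) => [|x v].
    by move: (size_drop p w); rewrite E sw /=; lia.
  exists (take p w), x, v; split; first by rewrite -E cat_take_drop.
    by rewrite size_takel // sw; lia.
  by move: (size_drop p w); rewrite E sw /=; lia.
have lj : lst x.2 v = j by rewrite -lw wE lst_cat.
have rE : rw i w = rw x.2 v ++ (x.1, lst i u) :: rw (n := n) i u.
  by rewrite wE rw_cat /= cat_rcons.
congr (_%:R * _).
  rewrite (saw_rw d lw) /bridged; congr (_ && _).
  rewrite rE take_size_cat ?size_rw // drop_size_cat ?size_rw //.
  rewrite wE take_size_cat // drop_size_cat //.
  rewrite (saw_rw d lj) (lst_rw lj) (hop_sym d (lst i u)) (saw_rw d (erefl (lst i u))).
  by rewrite andbCA andbA andbC andbA.
rewrite unzip1_rw -gpr_rev ?revK; last first.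
  by rewrite size_rev /ckinds /unzip1 !size_map sw size_cat /= size_mkprog size_map !size_nseq; lia.
congr (gpr _ _ _ _); rewrite /ckinds /= /unzip1 !map_cat /= -!/(unzip1 _).
rewrite !mkprogE !unzip1_pairf rev_cat rev_cons.
by rewrite !rev_nseq cat_rcons.
Qed.
End Copies.

(** * Moments of hyperedge indicators *)

Section SetSums.
Variables (R : comNzRingType) (T : finType).

Lemma big_subset_distr (D : {set T}) (F G : T -> R) :
  \sum_(H : {set T} | H \subset D) \prod_(e in D) (if e \in H then F e else G e) =
  \prod_(e in D) (F e + G e).
Proof.
rewrite [RHS]big_mkcond /=.
transitivity (\prod_(e : T) ((if e \in D then F e else 0) + (if e \in D then G e else 1))).
  rewrite (@bigA_distr _ _ _ _ _ _ (fun e => if e \in D then F e else 0)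
                      (fun e => if e \in D then G e else 1)) big_mkcond /=.
  apply: eq_bigr => H _; case: ifPn => [HD|].
    rewrite big_mkcond /=; apply: eq_bigr => e _.
    case: ifPn => // eD; case: ifPn => // eH.
    by move/subsetP: HD => /(_ e eH); rewrite (negbTE eD).
  move/subsetPn => [e eH eD].
  by rewrite (bigD1 e) //= eH (negbTE eD) mul0r.
by apply: eq_bigr => e _; case: ifP => //; rewrite add0r.
Qed.
End SetSums.

Section DSets.
Variables n d : nat.

Lemma card_dsets_sup (Z : {set 'I_n}) :
  (#|[set e : {set 'I_n} | Z \subset e & #|e| == d]| <= 'C(n - #|Z|, d - #|Z|))%N.
Proof.
have -> : (n - #|Z|)%N = #|~: Z| by have := cardsC Z; rewrite card_ord; lia.
rewrite -cards_draws -(card_in_imset (f := fun e : {set 'I_n} => e :\: Z)).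
  apply: subset_leq_card; apply/subsetP => _ /imsetP [e + ->].
  rewrite !inE => /andP [Ze /eqP ed]; rewrite setDE subsetIr /= -setDE.
  by rewrite cardsD (setIidPr Ze) ed.
move=> e1 e2; rewrite !inE => /andP [Z1 _] /andP [Z2 _] eq12.
by rewrite -(setID e1 Z) -(setID e2 Z) eq12 (setIidPr Z1) (setIidPr Z2).
Qed.

End DSets.

Section EdgeMoments.
Variable R : realType.
Implicit Types (p : R) (r : seq kind).

Definition kfac p (k : kind) (h : bool) : R :=
  match k with
  | Some true => h%:R - p
  | Some false => h%:R
  | None => p
  end.

Lemma prod_kfac p r h :
  \prod_(k <- r) kfac p k h =
  p ^+ count_mem bri r * ((h%:R - p) ^+ count_mem cen r * h%:R ^+ count_mem non r).
Proof.
elim: r => [|k r IH]; first by rewrite big_nil !expr0 !mulr1.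
rewrite big_cons IH /=; case: k => [[]|] /=; rewrite ?add0n ?add1n ?exprS; ring.
Qed.

Definition moment_bound p r : R :=
  if has (predC1 bri) r then
    (if (count_mem cen r == 1%N) && (count_mem non r == 0%N) then 0 else p)
  else 1.

(** Each bridge contributes a constant p. Of the rest, a plain factor forces presence of the
    hyperedge and leaves at most p; a lone centred factor has mean zero; two or more give at most
    p(1-p)^2 + (1-p)p^2 <= p. *)
Lemma edge_moment p r : 0 <= p <= 1 ->
  `|p * \prod_(k <- r) kfac p k true + (1 - p) * \prod_(k <- r) kfac p k false| <=
  p ^+ count_mem bri r * moment_bound p r.
Proof.
move=> /andP [p0 p1]; rewrite !prod_kfac expr1n mulr1 sub0r expr0n.
rewrite /moment_bound.
have -> : has (predC1 bri) r = (0 < count_mem cen r + count_mem non r)%N.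
  by elim: r => //= k r ->; case: k => [[]|] //=; rewrite addnS.
set u := count_mem cen r; set v := count_mem non r; set t := count_mem bri r.
rewrite [X in `|X|](_ : _ = p ^+ t * (p * (1 - p) ^+ u + (1 - p) * ((- p) ^+ u * (v == 0%N)%:R))); last by ring.
rewrite normrM ger0_norm ?exprn_ge0 // ler_wpM2l ?exprn_ge0 //.
have q0 : 0 <= 1 - p by lra.
have q1 : 1 - p <= 1 by lra.
case: v => [|v] /=; last first.
  rewrite addnS /= andbF !mulr0 addr0 ger0_norm ?mulr_ge0 ?exprn_ge0 //.
  by rewrite ler_piMr // exprn_ile1.
rewrite addn0 mulr1; case: u => [|[|u]] /=.
- by rewrite !expr0 !mulr1 addrC subrK normr1.
- by rewrite !expr1 (_ : _ + _ = 0) ?normr0 //; ring.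
- apply: (le_trans (ler_normD _ _)).
  rewrite normrM normrX [X in _ + X]normrM normrX normrN !ger0_norm // !exprS.
  have h1 : (1 - p) ^+ u <= 1 by rewrite exprn_ile1.
  have h2 : p ^+ u <= 1 by rewrite exprn_ile1.
  have g1 : 0 <= (1 - p) ^+ u by rewrite exprn_ge0.
  have g2 : 0 <= p ^+ u by rewrite exprn_ge0.
  have e1 : p * ((1 - p) * ((1 - p) * (1 - p) ^+ u)) <= p * ((1 - p) * (1 - p)).
    by rewrite !ler_wpM2l // ler_piMr.
  have e2 : (1 - p) * (p * (p * p ^+ u)) <= (1 - p) * (p * p).
    by rewrite !ler_wpM2l // ler_piMr.
  nra.
Qed.
End EdgeMoments.

Section EdgeKinds.
Variables n d : nat.
Implicit Types (ks : seq kind) (es : seq {set 'I_n}) (e : {set 'I_n}).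

Definition kof (ks : seq kind) (es : seq {set 'I_n}) e : seq kind :=
  [seq p.1 | p <- zip ks es & p.2 == e].

(** Bridge factors are constants given the spins, so these are the hyperedges whose presence matters
    for the product. *)
Definition nbset ks es : {set {set 'I_n}} :=
  [set e | has (predC1 bri) (kof ks es e)].

Definition covered ks es : bool :=
  [forall e in nbset ks es,
    ~~ ((count_mem cen (kof ks es e) == 1%N) && (count_mem non (kof ks es e) == 0%N))].

Lemma sum_count_kof ks es k : size ks = size es ->
  (\sum_e count_mem k (kof ks es e))%N = count_mem k ks.
Proof.
move=> sz; rewrite -{2}(unzip1_zip (s := ks) (t := es)) ?sz // /unzip1 count_map.
rewrite -sum1_count (partition_big snd xpredT) //=; apply: eq_bigr => e _.
by rewrite /kof count_map count_filter -sum1_count.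
Qed.

Lemma kof_size ks es e : all (fun e => #|e| == d) es -> e \notin dsets d n ->
  kof ks es e = [::].
Proof.
rewrite inE => /allP ds en; rewrite /kof.
elim: es ks ds => [|e' es IH] [|k ks] //= ds.
case: eqP => [ee|_]; first by rewrite -ee ds ?mem_head in en.
by apply: IH => x xs; apply: ds; rewrite inE xs orbT.
Qed.

(** Double counting with weight one for a centred and two for a plain factor: every such hyperedge
    receives weight at least two. This gives the final power of alpha. *)
Lemma covered_card ks es : size ks = size es -> covered ks es ->
  (#|nbset ks es|.*2 <= count_mem cen ks + (count_mem non ks).*2)%N.
Proof.
move=> sz /forall_inP cv.
rewrite -(sum_count_kof cen sz) -(sum_count_kof non sz) -!muln2 -sum1_card.
rewrite !big_distrl -big_split /= big_mkcond /=.
apply: leq_sum => e _; case: ifP => // eS; have := cv _ eS.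
move: eS; rewrite inE => hs.
have : (0 < count_mem cen (kof ks es e) + count_mem non (kof ks es e))%N.
  by move: hs; elim: (kof ks es e) => //= -[[]|] r IH //= hs; rewrite ?addnS // IH.
by move: (count_mem _ _) (count_mem _ _) => u v; case: u => [|[|u]]; case: v => [|v] //=; lia.
Qed.

End EdgeKinds.

(** * Expected products of factors, and averages over the spins *)

Section Model.
Variables (R : realType) (n d : nat) (a b : R).
Hypothesis b0 : 0 < b.
Hypothesis ba : b <= a.
Implicit Types (s : spins n) (e : {set 'I_n}) (S : {set {set 'I_n}}).

Notation pa := (pn d a n).
Notation pb := (pn d b n).
Notation ep := (edge_prob d a b).

Lemma pn_ge0 (c : R) : 0 <= c -> 0 <= pn d c n.
Proof. by move=> c0; rewrite /pn le_min ler01 divr_ge0. Qed.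

Lemma pn_le1 (c : R) : pn d c n <= 1.
Proof. by rewrite /pn ge_min lexx. Qed.

Lemma pn_mul_bin (c : R) : 0 <= c -> pn d c n * 'C(n, d.-1)%:R <= c.
Proof.
move=> c0; case: (posnP 'C(n, d.-1)) => [->|C0]; first by rewrite mulr0.
by rewrite -ler_pdivlMr ?ltr0n // /pn ge_min lexx orbT.
Qed.

Lemma pn_le : pb <= pa.
Proof. by rewrite /pn le_min2 // ler_wpM2r // invr_ge0. Qed.

Lemma a_ge0 : 0 <= a. Proof. exact: le_trans (ltW b0) ba. Qed.

Lemma ep_ge0 s e : 0 <= ep s e.
Proof. by rewrite /edge_prob; case: ifP => _; apply: pn_ge0; rewrite ?a_ge0 // ltW. Qed.

Lemma ep_le s e : ep s e <= pa.
Proof. by rewrite /edge_prob; case: ifP => _ //; exact: pn_le. Qed.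

Lemma ep_le1 s e : ep s e <= 1.
Proof. exact: le_trans (ep_le _ _) (pn_le1 _). Qed.

Lemma gpr_split s (H : hgraph n) ks es :
  gpr d a b s H ks es = \prod_e \prod_(k <- kof ks es e) kfac (ep s e) k (e \in H).
Proof.
rewrite /gpr (partition_big snd xpredT) //=; apply: eq_bigr => e _.
rewrite /kof big_map big_filter; apply: eq_bigr => -[k e'] /= /eqP->.
by case: k => [[]|].
Qed.

(** Given the spins the hyperedges are independent, so the expectation factors over d-sets and
    [edge_moment] applies to each; a single uncovered hyperedge makes the product vanish. *)
Lemma expect_gpr s ks es : size ks = size es -> all (fun e => #|e| == d) es ->
  `|\sum_(H : hgraph n | H \subset dsets d n) weight d a b s H * gpr d a b s H ks es| <=
  2 ^- n * (pa ^+ count_mem bri ks *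
            (if covered ks es then \prod_(e in nbset ks es) ep s e else 0)).
Proof.
move=> sz ds.
have pr e : 0 <= ep s e <= 1 by rewrite ep_ge0 ep_le1.
pose f e h := \prod_(k <- kof ks es e) kfac (ep s e) k h.
rewrite (_ : \sum_(H | _) _ =
  2 ^- n * \prod_(e in dsets d n) (ep s e * f e true + (1 - ep s e) * f e false)); last first.
  rewrite -big_subset_distr mulr_sumr; apply: eq_bigr => H _.
  rewrite /weight -mulrA; congr (_ * _).
  rewrite gpr_split [X in _ * X](bigID (mem (dsets d n))) /= [X in _ * (_ * X)]big1 ?mulr1.
    by rewrite -big_split /=; apply: eq_bigr => e _; rewrite /f; case: ifP.
  by move=> e en; rewrite (kof_size _ ds) // big_nil.
rewrite normrM ger0_norm ?invr_ge0 ?exprn_ge0 // ler_wpM2l ?invr_ge0 ?exprn_ge0 //.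
rewrite normr_prod.
apply: (@le_trans _ _ (\prod_(e in dsets d n)
   (pa ^+ count_mem bri (kof ks es e) * moment_bound (ep s e) (kof ks es e)))).
  apply: ler_prod => e _; rewrite normr_ge0 /=.
  apply: (le_trans (edge_moment _ (pr e))); apply: ler_wpM2r.
    by rewrite /moment_bound; do 2 case: ifP => // _; exact: ep_ge0.
  by rewrite lerXn2r ?nnegrE ?ep_ge0 ?pn_ge0 ?a_ge0 ?ep_le.
rewrite (_ : \prod_(e in _) _ = \prod_e (pa ^+ count_mem bri (kof ks es e) *
    moment_bound (ep s e) (kof ks es e))); last first.
  rewrite big_mkcond /=; apply: eq_bigr => e _; case: ifPn => // en.
  by rewrite (kof_size _ ds) //= mulr1.
rewrite big_split /= -expr_sum sum_count_kof // ler_wpM2l ?exprn_ge0 ?pn_ge0 ?a_ge0 //.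
rewrite (_ : \prod_e _ = \prod_(e in nbset ks es)
  (if (count_mem cen (kof ks es e) == 1%N) && (count_mem non (kof ks es e) == 0%N)
   then 0 else ep s e)); last first.
  by rewrite [RHS]big_mkcond /=; apply: eq_bigr => e _; rewrite /moment_bound inE.
case: ifPn => [/forall_inP cv|].
  by rewrite le_eqVlt; apply/orP; left; apply/eqP; apply: eq_bigr => e /cv /negbTE ->.
rewrite negb_forall => /existsP [e]; rewrite negb_imply negbK => /andP [eS eb].
by rewrite (bigD1 e) //= eb mul0r.
Qed.

(* The probability that all hyperedges of S are present. *)
Definition PS S : R := \sum_(s : spins n) 2 ^- n * \prod_(e in S) ep s e.

Lemma PS_ge0 S : 0 <= PS S.
Proof.
apply: sumr_ge0 => s _; rewrite mulr_ge0 ?invr_ge0 ?exprn_ge0 //.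
by apply: prodr_ge0 => e _; exact: ep_ge0.
Qed.

Lemma PS_set0 : PS finset.set0 = 1.
Proof.
rewrite /PS; under eq_bigr do rewrite big_set0 mulr1.
rewrite sumr_const card_ffun card_bool card_ord -(mulr_natl (2 ^- n)) natrX mulfV //.
Qed.

Lemma PS_setU1 S e : e \notin S -> PS (e |: S) <= PS S * pa.
Proof.
move=> eS; rewrite /PS mulr_suml; apply: ler_sum => s _.
rewrite big_setU1 //= -mulrA ler_wpM2l ?invr_ge0 ?exprn_ge0 // mulrC.
by rewrite ler_wpM2l ?ep_le // prodr_ge0 // => i _; exact: ep_ge0.
Qed.

(** The probability of a hyperedge averaged over the spins, which all agree with probability
    2^(1-d). *)
Definition pbar : R := (pa + (2 ^+ d.-1 - 1) * pb) / 2 ^+ d.-1.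

Definition flip (F : {set 'I_n}) s : spins n := [ffun i => s i (+) (i \in F)].

Lemma flipK F : involutive (flip F).
Proof. by move=> s; apply/ffunP => i; rewrite !ffunE addbK. Qed.

Lemma agreeE s e x : x \in e -> agree s e = [forall y in e, s y == s x].
Proof.
move=> xe; apply/forall_inP/forall_inP => [h y ye|h y ye].
  by move/forall_inP: (h y ye) => /(_ x xe).
by apply/forall_inP => z ze; rewrite (eqP (h y ye)) (eqP (h z ze)).
Qed.

(* Average over the spin flips supported in e :\ x: exactly one of them makes e
   monochromatic. *)
Lemma sum_agree (g : spins n -> R) e x : x \in e ->
  (forall (F : {set 'I_n}) s, F \subset e :\ x -> g (flip F s) = g s) ->
  2 ^+ #|e|.-1 * \sum_s g s * (agree s e)%:R = \sum_s g s.
Proof.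
move=> xe gF.
have -> : 2 ^+ #|e|.-1 = (\sum_(F in powerset (e :\ x)) 1 : R).
  by rewrite sumr_const card_powerset (cardsD1 x e) xe add1n /= -natrX.
rewrite mulr_suml.
transitivity (\sum_(F in powerset (e :\ x)) \sum_s g s * (agree (flip F s) e)%:R).
  apply: eq_bigr => F; rewrite powersetE => Fe; rewrite mul1r.
  rewrite [RHS](reindex_inj (inv_inj (flipK F))) /=.
  by apply: eq_bigr => s _; rewrite gF // flipK.
rewrite exchange_big /=; apply: eq_bigr => s _; rewrite -mulr_sumr.
rewrite [X in _ * X](_ : _ = 1) ?mulr1 //.
pose F0 := [set y in e | s y != s x].
have F0e : F0 \in powerset (e :\ x).
  rewrite powersetE; apply/subsetP => y; rewrite !inE => /andP [-> ny].
  by rewrite andbT; apply: contraNneq ny => ->.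
rewrite (bigD1 F0) //= [X in _ + X]big1 ?addr0.
  rewrite (agreeE _ xe) [X in nat_of_bool X](_ : _ = true) //; apply/forall_inP => y ye.
  by rewrite !ffunE !inE ye xe eqxx /= addbF; case: (s y); case: (s x).
move=> F /andP [Fe nF]; rewrite (agreeE _ xe) [X in nat_of_bool X](_ : _ = false) //.
apply: contraNF nF => /forall_inP h; apply/eqP/setP => y.
rewrite powersetE in Fe; move/subsetP: Fe => Fe.
have xF : x \notin F by apply/negP => /Fe; rewrite !inE eqxx.
rewrite !inE; case ye: (y \in e) => /=.
  have := h y ye; rewrite !ffunE (negbTE xF) addbF.
  by case: (y \in F); case: (s y); case: (s x).
by apply/negP => /Fe; rewrite !inE ye andbF.
Qed.

(** The spins of [e] other than that of [x] occur in no hyperedge of [S], so averaging over their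
    flips decouples [e]. This is the source of the rate alpha, in place of the cruder (d-1)a. *)
Lemma PS_fresh S e x : #|e| = d -> x \in e -> e \notin S ->
  (forall e', e' \in S -> [disjoint e :\ x & e']) ->
  PS (e |: S) = PS S * pbar.
Proof.
move=> ed xe eS dis.
pose g s := 2 ^- n * \prod_(e' in S) ep s e' : R.
have gF (F : {set 'I_n}) s : F \subset e :\ x -> g (flip F s) = g s.
  move=> Fe; congr (_ * _); apply: eq_bigr => e' e'S.
  rewrite /edge_prob; congr (if _ then _ else _).
  have flE y : y \in e' -> flip F s y = s y.
    move=> ye'; rewrite ffunE (_ : y \in F = false) ?addbF //.
    apply: contraTF ye' => yF; have /disjointFr := dis e' e'S.
    by move=> -> //; move/subsetP: Fe => ->.
  by apply: eq_forallb_in => y ye; apply: eq_forallb_in => z ze; rewrite !flE.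
have sa := sum_agree xe gF.
have two : 2 ^+ d.-1 != 0 :> R by rewrite expf_neq0 // pnatr_eq0.
have sa' : \sum_s g s * (agree s e)%:R = PS S / 2 ^+ d.-1.
  by rewrite /PS -/(\sum_s g s) -sa ed mulrAC mulfV // mul1r.
rewrite /PS (_ : \sum_s _ = \sum_s (g s * pb + (pa - pb) * (g s * (agree s e)%:R))); last first.
  apply: eq_bigr => s _; rewrite big_setU1 //= /g; set P := \prod_(_ in S) _; rewrite /edge_prob.
  by move: (2 ^- n) => c; case: (agree s e) => /=; ring.
transitivity ((\sum_s g s) * pb + (pa - pb) * \sum_s g s * (agree s e)%:R).
  by rewrite mulr_suml mulr_sumr -big_split.
rewrite sa' -/(PS S) /pbar.
by field.
Qed.

Lemma pbar_ge0 : 0 <= pbar.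
Proof.
rewrite /pbar divr_ge0 ?exprn_ge0 // addr_ge0 ?pn_ge0 ?a_ge0 // mulr_ge0 ?pn_ge0 //; last exact: ltW.
by rewrite subr_ge0 exprn_ege1 // ler1n.
Qed.

Lemma fresh_rate : (0 < n)%N -> (d.-1 * 'C(n.-1, d.-1))%:R * pbar <= alpha d a b.
Proof.
move=> n0; rewrite /alpha /pbar natrM -!mulrA ler_wpM2l ?ler0n //.
rewrite !mulrA ler_wpM2r ?invr_ge0 ?exprn_ge0 //.
apply: (@le_trans _ _ ('C(n, d.-1)%:R * (pa + (2 ^+ d.-1 - 1) * pb))).
  apply: ler_wpM2r; last by rewrite ler_nat leq_bin2l // leq_pred.
  rewrite addr_ge0 ?pn_ge0 ?a_ge0 // mulr_ge0 ?pn_ge0 //; last exact: ltW.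
  by rewrite subr_ge0 exprn_ege1 // ler1n.
rewrite mulrDr lerD //; first by rewrite mulrC pn_mul_bin ?a_ge0.
rewrite mulrCA ler_wpM2l ?subr_ge0 ?exprn_ege1 ?ler1n //.
by rewrite mulrC pn_mul_bin ?ltW.
Qed.

(** At most C(n-2, d-2) hyperedges pass through two given vertices, which absorbs the factor n
    attached to a collision. *)
Lemma hit_rate : (1 < d)%N -> (0 < n)%N ->
  n%:R * pa * 'C(n - 2, d - 2)%:R <= (d.-1)%:R * a.
Proof.
move=> d1 n0; apply: (@le_trans _ _ ((d.-1)%:R * (pa * 'C(n, d.-1)%:R))); last first.
  by rewrite ler_wpM2l ?ler0n // pn_mul_bin ?a_ge0.
have N : (n * 'C(n - 2, d - 2) <= d.-1 * 'C(n, d.-1))%N.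
  have -> : d.-1 = (d - 2).+1 by lia.
  by rewrite -mul_bin_diag leq_mul2l leq_bin2l ?orbT //; lia.
rewrite mulrAC -natrM [X in X <= _]mulrC [X in _ <= X]mulrCA -natrM.
by rewrite ler_wpM2l ?pn_ge0 ?a_ge0 // ler_nat.
Qed.
End Model.

(** * Exploration of a chain of walks *)

(* LX: impossible step; LF: fresh hyperedge; LU, LD: step along a seen fresh
   hyperedge to its root, respectively to another vertex; LC: new hyperedge meeting
   seen vertices; LO: seen hyperedge created by LC; LBn, LBf: bridge that does,
   respectively does not, meet seen vertices. *)
Inductive label := LX | LF | LU | LD | LC | LO | LBn | LBf.

Section Machine.
Variables (n d : nat).
Notation X := ({set 'I_n} * 'I_n)%type.

(* [coll] is the set of hyperedges created by collisions, [used] those of the current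
   walk, and [pf z] is the fresh hyperedge that discovered z together with its root.
   [md] is the regime: 0 at a start or after LC, LO, LBn; 1 ascent; 2 descent;
   3 isolated vertex.  The counters are the numbers of changes of regime, of gained
   factors 1/n, of fresh hyperedges, and of restarts and bridges. *)
Record state := State {
  cur : 'I_n;
  vis : {set 'I_n};
  seen : {set {set 'I_n}};
  coll : {set {set 'I_n}};
  used : {set {set 'I_n}};
  pf : 'I_n -> X;
  md : nat;
  nQ : nat; nG : nat; nF : nat; nJ : nat }.

Implicit Types (s : state) (x : X) (w : seq X) (p : seq instr).

Definition hit s x : bool := ~~ [disjoint x.1 :\ cur s & vis s].

(** From regimes 0 and 1 a descent may go to any vertex discovered by the hyperedge, hence also to a
    sibling of the current vertex; inside a descent only children are allowed. Legal steps never
    receive [LX] ([labP]). *)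
Definition label_of (is_bridge : bool) s x : label :=
  if ~~ hop d (cur s) x then LX else
  if is_bridge then (if hit s x then LBn else LBf) else
  if x.1 \in used s then LX else
  if x.1 \notin seen s then (if hit s x then LC else LF) else
  if x.2 \notin vis s then LX else
  if x.1 \in coll s then LO else
  if (x == pf s (cur s)) && (md s <= 1)%N then LU else
  if (x.1 == (pf s x.2).1) && ((md s <= 1)%N || (md s == 2%N) && ((pf s x.2).2 == cur s))
  then LD else LX.

Definition chg s (l : label) : bool :=
  match l with
  | LF => md s != 3%N
  | LU => md s != 1%N
  | LD => md s != 2%N
  | _ => true
  end.

(** A bridge enters [vis] but not [seen]: its factor is constant given the spins, yet a later return
    to its vertices must count as a collision. *)
Definition update s (l : label) x : state :=
  let: (e, y) := x in
  match l with
  | LX => s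
  | LF => State y (vis s :|: e) (e |: seen s) (coll s) (e |: used s)
            (fun z => if (z \in e) && (z != cur s) then (e, cur s) else pf s z)
            3 (nQ s + chg s LF) (nG s) (nF s).+1 (nJ s)
  | LU => State y (vis s) (seen s) (coll s) (e |: used s) (pf s)
            1 (nQ s + chg s LU) (nG s) (nF s) (nJ s)
  | LD => State y (vis s) (seen s) (coll s) (e |: used s) (pf s)
            2 (nQ s + chg s LD) (nG s) (nF s) (nJ s)
  | LO => State y (vis s) (seen s) (coll s) (e |: used s) (pf s)
            0 (nQ s).+1 (nG s) (nF s) (nJ s)
  | LC => State y (vis s :|: e) (e |: seen s) (e |: coll s) (e |: used s) (pf s)
            0 (nQ s).+1 (nG s).+1 (nF s) (nJ s)
  | LBn => State y (vis s :|: e) (seen s) (coll s) finset.set0 (pf s)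
            0 (nQ s).+1 (nG s).+1 (nF s) (nJ s).+1
  | LBf => State y (vis s :|: e) (seen s) (coll s) finset.set0 (pf s)
            3 (nQ s).+1 (nG s) (nF s) (nJ s).+1
  end.

Definition restart s : state :=
  State (cur s) (vis s) (seen s) (coll s) finset.set0 (pf s) 0 (nQ s) (nG s) (nF s) (nJ s).+1.

Definition prep (i : instr) s : state := if i.2 then restart s else s.

Definition is_bridge (i : instr) : bool := i.1 == bri.

Definition advance (i : instr) s x : state := update (prep i s) (label_of (is_bridge i) (prep i s) x) x.

Fixpoint explore p s w : state :=
  match p, w with
  | i :: p', x :: w' => explore p' (advance i s x) w'
  | _, _ => s
  end.

Lemma explore_cat p1 p2 s w1 w2 : size p1 = size w1 ->
  explore (p1 ++ p2) s (w1 ++ w2) = explore p2 (explore p1 s w1) w2.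
Proof.
by elim: p1 w1 s => [|i p1 IH] [|x w1] s //= [] sz; rewrite IH.
Qed.

Lemma cur_update b s x : hop d (cur s) x -> cur s \in vis s ->
  cur (update s (label_of b s x) x) \in vis (update s (label_of b s x) x).
Proof.
case: x => e y hx cv; have /and4P [_ _ _ /= ye] := hx.
rewrite /label_of hx /=; case: b; first by case: ifP => _ /=; rewrite inE ye orbT.
case: ifP => _ //; case: ifP => _; first by case: ifP => _ /=; rewrite inE ye orbT.
case: ifPn => //; rewrite negbK => yv.
by do 3?[case: ifP => _ //=].
Qed.

Lemma card_vis_update s l x : (#|vis (update s l x)| <= #|vis s| + #|x.1|)%N.
Proof. by case: x => e y; case: l => /=; rewrite ?leq_addr // leq_card_setU. Qed.

Lemma card_coll_update s l x : (#|coll (update s l x)| <= (#|coll s|).+1)%N.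
Proof.
by case: x => e y; case: l => //=; rewrite cardsU1 -add1n leq_add2r leq_b1.
Qed.

Definition anc s q (v : 'I_n) : 'I_n := iter q (fun z => (pf s z).2) v.

(** Truncating the depth at the number of remaining steps bounds the total ([cnt_total]) without an
    acyclicity argument for the parent map. *)
Definition cnt s N (c : 'I_n) : nat := \sum_(v in vis s) \sum_(q < N.+1) (anc s q v == c).

(* During a descent the potential counts the pairs (v, q) such that v is a
   descendant of the current vertex at depth q <= N; a child takes over its share. *)
Definition pot N s : nat := if md s == 2%N then cnt s N (cur s) else 1%N.

Lemma pot_gt0 N s : cur s \in vis s -> (0 < pot N s)%N.
Proof.
move=> cv; rewrite /pot; case: ifP => // _.
by rewrite /cnt (bigD1 (cur s)) //= big_ord_recl /= eqxx.
Qed.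

(** A pair (v, q) counted at a child becomes the pair (v, q+1) at the parent, and distinct children
    give distinct pairs. *)
Lemma cnt_children s N c :
  (\sum_y ((pf s y).2 == c) * cnt s N y <= cnt s N.+1 c)%N.
Proof.
under eq_bigr => y _ do rewrite big_distrr /=.
rewrite exchange_big /=; apply: leq_sum => v _.
under eq_bigr => y _ do rewrite big_distrr /=.
rewrite exchange_big /= [X in (_ <= X)%N]big_ord_recl; apply: leq_trans (leq_addl _ _).
apply: leq_sum => q _; rewrite (bigD1 (anc s q v)) //= eqxx muln1 big1 ?addn0.
  by [].
by move=> y /negbTE; rewrite eq_sym => ->; rewrite muln0.
Qed.

Lemma cnt_total s N : (\sum_y cnt s N y = #|vis s| * N.+1)%N.
Proof.
rewrite exchange_big /= -sum_nat_const; apply: eq_bigr => v _.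
rewrite exchange_big /= -[RHS]card_ord -sum1_card; apply: eq_bigr => q _.
by rewrite (bigD1 (anc s q v)) //= eqxx big1 // => y /negbTE; rewrite eq_sym => ->.
Qed.

Lemma sum_hop i (P : pred {set 'I_n}) :
  (\sum_(x : X) (hop d i x && P x.1) =
   d.-1 * #|[set e : {set 'I_n} | [&& #|e| == d, i \in e & P e]]|)%N.
Proof.
rewrite -(pair_bigA _ (fun e y => (hop d i (e, y) && P e : nat))) /=.
rewrite mulnC -sum_nat_const big_mkcond [RHS]big_mkcond /=; apply: eq_bigr => e _.
rewrite inE; case: ifP => [/and3P [/eqP ed ie Pe]|nP].
  have -> : d.-1 = #|e :\ i| by rewrite -ed (cardsD1 i e) ie.
  rewrite -sum1_card [RHS]big_mkcond /=.
  by apply: eq_bigr => y _; rewrite /hop /= ed eqxx ie Pe !inE eq_sym andbT /=; case: ifP.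
rewrite big1 // => y _; rewrite /hop /=.
by move: nP; case: (_ == d); case: (i \in e); case: (P e) => //=; rewrite ?andbF ?andbT.
Qed.

Lemma sum_hop_le i : (\sum_(x : X) hop d i x <= d.-1 * 'C(n.-1, d.-1))%N.
Proof.
have := sum_hop i predT; under eq_bigr do rewrite andbT; move=> ->.
rewrite leq_mul2l; apply/orP; right.
have := card_dsets_sup d [set i]; rewrite cards1 !subn1; apply: leq_trans.
by apply: subset_leq_card; apply/subsetP => e; rewrite !inE sub1set andbT andbC.
Qed.

Lemma sum_hit_le s : (\sum_(x : X) (hop d (cur s) x && hit s x) <=
   d.-1 * (#|vis s| * 'C(n - 2, d - 2)))%N.
Proof.
rewrite (sum_hop (cur s) (fun e => hit s (e, cur s))) leq_mul2l; apply/orP; right.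
set i := cur s.
apply: (@leq_trans #|\bigcup_(z in vis s :\ i)
    [set e : {set 'I_n} | [set i; z] \subset e & #|e| == d]|).
  apply: subset_leq_card; apply/subsetP => e; rewrite inE => /and3P [ed ie].
  rewrite /hit -setI_eq0 => /set0Pn [z]; rewrite !inE => /andP [/andP [zi ze] zv].
  apply/bigcupP; exists z; first by rewrite !inE zi.
  by rewrite inE ed andbT subUset !sub1set ie ze.
apply: (@leq_trans (\sum_(z in vis s :\ i) 'C(n - 2, d - 2))%N); last first.
  by rewrite sum_nat_const leq_mul2r; apply/orP; right; apply: subset_leq_card; exact: subsetDl.
apply: (big_ind2 (fun (A : {set {set 'I_n}}) (m : nat) => (#|A| <= m)%N)).
- by rewrite cards0.
- move=> A1 m1 A2 m2 h1 h2; apply: leq_trans (leq_card_setU _ _) _; exact: leq_add.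
- move=> z; rewrite !inE => /andP [zi _].
  have := card_dsets_sup d [set i; z]; rewrite cards2 eq_sym zi; exact.
Qed.

Lemma sum_coll_le s (A : {set {set 'I_n}}) :
  (\sum_(x : X) (hop d (cur s) x && (x.1 \in A)) <= d * #|A|)%N.
Proof.
rewrite (sum_hop (cur s) (fun e => e \in A)) leq_mul ?leq_pred //.
by apply: subset_leq_card; apply/subsetP => e; rewrite inE => /and3P [].
Qed.

(** * Summing the discounted weights over all words *)

Section Kernel.
Variables (R : realType) (pa pbar theta alp : R).

(* The weight of a step, times n for a gained factor 1/n, over alp for a fresh
   hyperedge. *)
Definition label_weight (l : label) : R :=
  match l with
  | LX => 0
  | LF => pbar / alp
  | LC | LBn => n%:R * pa
  | LBf => pa
  | _ => 1
  end.

(** The discount [theta] at each change of regime is repaid later through [credit]. *)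
Definition step_weight b s x : R :=
  let l := label_of b s x in label_weight l * (if chg s l then theta else 1).

Fixpoint run_weight p s w : R :=
  match p, w with
  | i :: p', x :: w' => step_weight (is_bridge i) (prep i s) x * run_weight p' (advance i s x) w'
  | _, _ => 1
  end.

Variables (C1 delta : R) (V : nat).
Hypothesis pa0 : 0 <= pa.
Hypothesis pbar0 : 0 <= pbar.
Hypothesis alp0 : 0 < alp.
Hypothesis th0 : 0 <= theta.
Hypothesis C10 : 0 <= C1.
Hypothesis freshR : (d.-1 * 'C(n.-1, d.-1))%:R * pbar <= alp.
Hypothesis freeR : (d.-1 * 'C(n.-1, d.-1))%:R * pa <= C1.
Hypothesis hitR : d.-1%:R * (n%:R * pa * 'C(n - 2, d - 2)%:R) <= C1.
Hypothesis thetaR : theta * (2 + C1 + (V * V)%:R + C1 * V%:R + (d * V)%:R) <= delta.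

Lemma label_weight_ge0 l : 0 <= label_weight l.
Proof.
have pba := divr_ge0 pbar0 (ltW alp0).
by case: l => //=; rewrite mulr_ge0.
Qed.

Lemma step_weight_ge0 b s x : 0 <= step_weight b s x.
Proof. by rewrite /step_weight mulr_ge0 ?label_weight_ge0 //; case: ifP. Qed.

Lemma run_weight_ge0 p s w : 0 <= run_weight p s w.
Proof.
by elim: p s w => [|i p IH] s [|x w] //=; rewrite mulr_ge0 ?IH ?step_weight_ge0.
Qed.

Lemma sum_hop_real i : \sum_(x : X) (hop d i x)%:R <= (d.-1 * 'C(n.-1, d.-1))%:R :> R.
Proof. by rewrite -natr_sum ler_nat sum_hop_le. Qed.

Lemma sum_hit_real s : theta * (n%:R * pa) * \sum_(x : X) (hop d (cur s) x && hit s x)%:R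
  <= theta * (C1 * #|vis s|%:R).
Proof.
rewrite -mulrA ler_wpM2l // -natr_sum.
apply: (@le_trans _ _ (n%:R * pa * (d.-1 * (#|vis s| * 'C(n - 2, d - 2)))%:R)).
  by rewrite ler_wpM2l ?mulr_ge0 // ler_nat sum_hit_le.
rewrite !natrM [X in X <= _](_ : _ = (d.-1%:R * (n%:R * pa * 'C(n - 2, d - 2)%:R)) * #|vis s|%:R); last by ring.
by rewrite ler_wpM2r.
Qed.

Lemma budget (v w c : nat) : (v <= V)%N -> (w <= V)%N -> (c <= V)%N ->
  theta * (2 + C1 + (v * w)%:R + C1 * v%:R + (d * c)%:R) <= delta.
Proof.
move=> vV wV cV; apply: le_trans thetaR; rewrite ler_wpM2l //.
rewrite !lerD //; [by rewrite ler_nat leq_mul | by rewrite ler_wpM2l // ler_nat | ].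
by rewrite ler_nat leq_mul2l cV orbT.
Qed.

(** A bridge always counts as a change of regime and never ends in a descent, so every term carries
    [theta] and has potential one. *)
Lemma step_weight_sum_bridge N s : cur s \in vis s -> (#|vis s| <= V)%N ->
  \sum_(x : X) step_weight true s x * (pot N (update s (label_of true s x) x))%:R <= delta.
Proof.
move=> cv vV.
apply: (@le_trans _ _ (theta * (n%:R * pa) * \sum_(x : X) (hop d (cur s) x && hit s x)%:R
   + theta * pa * \sum_(x : X) (hop d (cur s) x)%:R)).
  rewrite !mulr_sumr -big_split /=; apply: ler_sum => -[e y] _.
  rewrite /step_weight /label_of; case: (hop d (cur s) (e, y)) => /=; last by rewrite !(mul0r, mulr0) addr0.
  case: (hit s (e, y)) => /=; rewrite /pot /= !mulr1.
    by rewrite (mulrC (n%:R * pa)) lerDl mulr_ge0.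
  by rewrite mulr0 add0r mulrC.
have := budget vV (leq0n V) (leq0n V); apply: le_trans.
apply: (le_trans (lerD (sum_hit_real s) (ler_wpM2l _ (sum_hop_real _)))); first exact: mulr_ge0.
rewrite muln0 muln0 -mulrA -mulrDr ler_wpM2l //.
have : pa * (d.-1 * 'C(n.-1, d.-1))%:R <= C1 by rewrite mulrC.
have : 0 <= C1 * #|vis s|%:R by rewrite mulr_ge0.
rewrite /=; lra.
Qed.

(** Each regime has at most one undiscounted continuation: fresh hyperedges (total at most one by
    [freshR]), the unique ascent, or the children in a descent ([cnt_children]). It is paid by the
    old potential; all the rest carries [theta] and fits into [delta]. *)
Lemma step_weight_sum_walk N s : cur s \in vis s -> (#|vis s| <= V)%N -> (N.+1 <= V)%N ->
  (#|coll s| <= V)%N ->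
  \sum_(x : X) step_weight false s x * (pot N (update s (label_of false s x) x))%:R
    <= (pot N.+1 s)%:R * (1 + delta).
Proof.
move=> cv vV NV cV.
pose cF : R := if md s == 3%N then 1 else theta.
pose cU : R := if md s == 1%N then 1 else theta.
(* Weight of a descent to [y] times the potential it leaves. *)
pose g y : R := if md s == 2%N then (((pf s y).2 == cur s) * cnt s N y)%:R
  else if (md s <= 1)%N then theta * (cnt s N y)%:R else 0.
have g0 y : 0 <= g y by rewrite /g; do 2 case: ifP => _ //; rewrite mulr_ge0.
have cF0 : 0 <= cF by rewrite /cF; case: ifP.
have cU0 : 0 <= cU by rewrite /cU; case: ifP.
have pba : 0 <= pbar / alp by rewrite divr_ge0 // ltW.
have S1 : cF * (pbar / alp) * \sum_(x : X) (hop d (cur s) x)%:R <= cF.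
  rewrite -mulrA ler_piMr //.
  apply: (le_trans (ler_wpM2l pba (sum_hop_real _))).
  by rewrite mulrAC ler_pdivrMr // mul1r mulrC.
have S2 : cU * \sum_(x : X) (x == pf s (cur s))%:R <= cU.
  by rewrite (bigD1 (pf s (cur s))) //= eqxx big1 ?addr0 ?mulr1 // => x /negbTE ->.
have S3 : \sum_(x : X) (x.1 == (pf s x.2).1)%:R * g x.2 <= \sum_y g y.
  rewrite -(pair_bigA _ (fun e y => (e == (pf s y).1)%:R * g y)) /= exchange_big /=.
  apply: ler_sum => y _; rewrite (bigD1 (pf s y).1) //= eqxx mul1r big1 ?addr0 //.
  by move=> e /negbTE ->; rewrite mul0r.
have S4 := sum_hit_real s.
have S5 : theta * \sum_(x : X) (hop d (cur s) x && (x.1 \in coll s))%:R <= theta * (d * #|coll s|)%:R.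
  by rewrite ler_wpM2l // -natr_sum ler_nat sum_coll_le.
(* In order: fresh hyperedges, ascent, descents, collisions, seen collision hyperedges. *)
apply: (@le_trans _ _ (cF + cU + \sum_y g y + theta * (C1 * #|vis s|%:R) + theta * (d * #|coll s|)%:R)).
  apply: le_trans (lerD (lerD (lerD (lerD S1 S2) S3) S4) S5).
  rewrite !mulr_sumr -!big_split /=; apply: ler_sum => -[e y] _.
  rewrite /step_weight /label_of /=.
  set A := cF * _ * _; set B := cU * _; set C := _ * g y; set D := theta * (n%:R * pa) * _; set E := theta * _%:R.
  have A0 : 0 <= A by apply: mulr_ge0 => //; exact: mulr_ge0.
  have B0 : 0 <= B by rewrite !mulr_ge0.
  have C0 : 0 <= C by rewrite !mulr_ge0.
  have D0 : 0 <= D by apply: mulr_ge0 => //; apply: mulr_ge0 => //; exact: mulr_ge0.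
  have E0 : 0 <= E by rewrite !mulr_ge0.
  have tot : 0 <= A + B + C + D + E by lra.
  case hh: (hop d (cur s) (e, y)) => /=; last by rewrite mul0r mul0r.
  case: ifP => _; first by rewrite mul0r mul0r.
  case: ifP => _.
    case: ifP => ht.
      rewrite /pot /= mulr1 mulrC.
      have -> : theta * (n%:R * pa) = D by rewrite /D hh ht mulr1.
      by lra.
    rewrite /pot /= mulr1.
    have -> : pbar / alp * (if md s != 3%N then theta else 1) = A.
      by rewrite /A hh mulr1 mulrC /cF; case: (md s == 3%N).
    by lra.
  case: ifP => _; first by rewrite mul0r mul0r.
  case: ifP => ec.
    rewrite /pot /= mulr1 mul1r.
    have -> : theta = E by rewrite /E hh ec mulr1.
    by lra.
  case: ifP => [/andP [eu _]|_].
    rewrite /pot /= mulr1 mul1r.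
    have -> : (if md s != 1%N then theta else 1) = B.
      by rewrite /B eu mulr1 /cU; case: (md s == 1%N).
    by lra.
  case: ifP => [/andP [ed ml]|_]; last by rewrite mul0r mul0r.
  have -> : 1 * (if md s != 2 then theta else 1) *
     (pot N {| cur := y; vis := vis s; seen := seen s; coll := coll s; used := e |: used s;
       pf := pf s; md := 2; nQ := nQ s + (md s != 2); nG := nG s; nF := nF s; nJ := nJ s |})%:R = C.
    rewrite /C ed !mul1r /g /pot /=.
    case: (md s =P 2%N) ml => [m2|m2] /=.
      by rewrite m2 /= => ->; rewrite !mul1r mul1n.
    by rewrite orbF => ->.
  by lra.
have gs : cF + cU + \sum_y g y <= (pot N.+1 s)%:R + theta * 2 + theta * (#|vis s| * N.+1)%:R.
  rewrite /cF /cU /g /pot; case: (md s) => [|[|[|m]]] /=.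
  - rewrite -mulr_sumr -natr_sum cnt_total; lra.
  - rewrite -mulr_sumr -natr_sum cnt_total lerD2r (addrC theta) lerD2l.
    by rewrite mulr_natr mulr2n lerDl.
  - rewrite -natr_sum; have : (\sum_y ((pf s y).2 == cur s) * cnt s N y)%:R <= (cnt s N.+1 (cur s))%:R :> R.
      by rewrite ler_nat cnt_children.
    have : 0 <= theta * (#|vis s| * N.+1)%:R by rewrite mulr_ge0.
    lra.
  - rewrite big1 // addr0; have : 0 <= theta * (#|vis s| * N.+1)%:R by rewrite mulr_ge0.
    by have := th0; case: ifP => _; lra.
have P1 : 1 <= (pot N.+1 s)%:R :> R by rewrite ler1n pot_gt0.
have bud := budget vV NV cV.
have d0 : 0 <= delta by apply: le_trans bud; rewrite mulr_ge0 // !addr_ge0 // mulr_ge0.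
have : delta <= (pot N.+1 s)%:R * delta by rewrite ler_peMl.
have : 0 <= theta * C1 by rewrite mulr_ge0.
move: bud; rewrite !mulrDr mulr1; lra.
Qed.

(** The depth parameter of the potential is the number of remaining steps, so it drops by one per
    step as the one-step bound requires; the slack in the hypotheses pays for the growth of [vis]
    and [coll]. *)
Lemma run_weight_sum p s : cur s \in vis s -> (#|vis s| + d * size p <= V)%N ->
  (#|coll s| + size p <= V)%N ->
  \sum_(w : (size p).-tuple X) run_weight p s w <= (pot (size p) s)%:R * (1 + delta) ^+ size p.
Proof.
have d0 : 0 <= delta by apply: le_trans thetaR; rewrite mulr_ge0 // !addr_ge0 // mulr_ge0.
elim: p s => [|i p IH] s cv hv hc.
  by rewrite (big_tuple0 (run_weight [::] s)) /= expr0 mulr1 ler1n pot_gt0.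
rewrite (big_tupleS _ (run_weight (i :: p) s)) /=.
have cv' : cur (prep i s) \in vis (prep i s) by rewrite /prep; case: ifP.
have hv' : (#|vis (prep i s)| + d * (size p).+1 <= V)%N by rewrite /prep; case: ifP.
have hc' : (#|coll (prep i s)| + (size p).+1 <= V)%N by rewrite /prep; case: ifP.
apply: (@le_trans _ _ (\sum_(x : X) step_weight (is_bridge i) (prep i s) x *
   ((pot (size p) (advance i s x))%:R * (1 + delta) ^+ size p))).
  apply: ler_sum => x _; rewrite -mulr_sumr.
  case: (boolP (hop d (cur (prep i s)) x)) => hx; last first.
    by rewrite /step_weight /label_of hx /= !mul0r.
  rewrite ler_wpM2l ?step_weight_ge0 //.
  apply: IH; rewrite /advance; set s' := prep i s in cv' hv' hc' hx *.
  - exact: cur_update.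
  - apply: (leq_trans (leq_add (card_vis_update _ _ _) (leqnn _))).
    by have /and4P [/eqP -> _ _ _] := hx; rewrite -addnA -mulnS.
  - apply: (leq_trans (leq_add (card_coll_update _ _ _) (leqnn _))).
    by rewrite addSnnS.
under eq_bigr do rewrite mulrA.
rewrite -mulr_suml exprS mulrA ler_wpM2r ?exprn_ge0 ?addr_ge0 //.
have vV : (#|vis (prep i s)| <= V)%N := leq_trans (leq_addr _ _) hv'.
have cV : (#|coll (prep i s)| <= V)%N := leq_trans (leq_addr _ _) hc'.
have NV : ((size p).+1 <= V)%N := leq_trans (leq_addl _ _) hc'.
rewrite /advance; case: (is_bridge i).
  apply: (le_trans (step_weight_sum_bridge _ cv' vV)).
  have P1 : 1 <= (pot (size p).+1 s)%:R :> R by rewrite ler1n pot_gt0.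
  apply: (@le_trans _ _ (1 + delta)); first by rewrite lerDr.
  by rewrite ler_peMl // addr_ge0.
apply: (le_trans (step_weight_sum_walk cv' vV NV cV)).
(* A restart leaves any descent, so its potential is one. *)
rewrite ler_wpM2r ?addr_ge0 // ler_nat /prep; case: ifP => // _.
by rewrite {1}/pot /= pot_gt0.
Qed.

End Kernel.
End Machine.

(** * Invariants of the exploration, and the number of changes of regime *)

Section Invariants.
Variables (n d : nat).
Notation X := ({set 'I_n} * 'I_n)%type.
Notation state := (state n).
Implicit Types (s : state) (x : X) (w : seq X) (p : seq instr).
Notation lab := (label_of d).
Notation run := (explore d).
Notation step := (advance d).

(* Within a walk [md] can only increase except at a collision hyperedge, and each of
   those is used at most once per walk. *)
Definition charge_bound (j g c : nat) : nat := (4 + 4 * j + 4 * g + 4 * (j * g + c))%N.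

(** The last field is amortised: [3 - md s] is what may still be spent before the next reset. Steps
    along collision hyperedges number at most [nG] per finished walk, and those of the current walk
    are counted by [used s :&: coll s]. *)
Record inv s : Prop := Inv {
  inv_cur : cur s \in vis s;
  inv_vis : forall e, e \in seen s -> e \subset vis s;
  inv_coll : coll s \subset seen s;
  inv_tree : forall e, e \in seen s -> e \notin coll s ->
    exists2 x, x \in e & forall z, z \in e -> z != x -> pf s z = (e, x);
  inv_down : md s = 2 -> (pf s (cur s)).1 \in used s;
  inv_fresh : md s = 3 -> forall e, e \in seen s -> cur s \in e -> e \in used s;
  inv_md : (md s <= 3)%N;
  inv_nG : (#|coll s| <= nG s)%N;
  inv_nF : (nF s <= #|seen s|)%N;
  inv_nQ : (nQ s + (3 - md s) <= charge_bound (nJ s) (nG s) #|used s :&: coll s|)%N }.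

(** The count [c] of the finished walk is absorbed into one more summand [g] of the product
    [j * g]. *)
Lemma charge_restart q m j g c : (c <= g)%N ->
  (q + m <= charge_bound j g c)%N -> (q + 4 <= charge_bound j.+1 g 0)%N.
Proof. by rewrite /charge_bound (mulSn j g); move: (j * g)%N => t; lia. Qed.

Lemma inv_restart s : inv s -> inv (restart s).
Proof.
case=> h1 h2 h3 h4 h5 h6 h7 h8 h9 h10; split => //=.
rewrite set0I cards0; apply: leq_trans (charge_restart _ h10); first by rewrite leq_add2l.
exact: leq_trans (subset_leq_card (subsetIr _ _)) h8.
Qed.

Lemma inv_prep i s : inv s -> inv (prep i s).
Proof. by move=> h; rewrite /prep; case: ifP => // _; exact: inv_restart. Qed.

Variant lab_spec (b : bool) s x : label -> Prop :=
| SpecBn of b & hit s x : lab_spec b s x LBn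
| SpecBf of b & ~~ hit s x : lab_spec b s x LBf
| SpecC of ~~ b & x.1 \notin seen s : lab_spec b s x LC
| SpecF of ~~ b & x.1 \notin seen s & ~~ hit s x : lab_spec b s x LF
| SpecO of ~~ b & x.1 \in seen s & x.1 \in coll s & x.2 \in vis s : lab_spec b s x LO
| SpecU of ~~ b & x.1 \in seen s & x.2 \in vis s & (md s <= 1)%N : lab_spec b s x LU
| SpecD of ~~ b & x.1 \in seen s & x.2 \in vis s & (pf s x.2).1 = x.1 & (md s <= 2)%N :
    lab_spec b s x LD.

(** On a seen forest hyperedge, regime 3 is excluded because every seen hyperedge at the current
    vertex is already used. If the current vertex is the root, the step is an ascent or reaches a
    child. Otherwise the hyperedge discovered the current vertex; in a descent it would be used
    already, so the regime is at most 1. *)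
Lemma labP b s x : inv s -> hop d (cur s) x -> b || (x.1 \notin used s) ->
  lab_spec b s x (lab b s x).
Proof.
case: x => e y iv hx; rewrite /lab hx /=; have /and4P [_ /= ny ce ye] := hx.
case: b => [_|/= nu]; first by case: ifPn => h; constructor.
rewrite (negbTE nu); case: ifPn => [es|]; first by case: ifPn => h; constructor.
rewrite negbK => es.
have yv : y \in vis s by move/subsetP: (inv_vis iv es); exact.
rewrite yv /=; case: ifPn => [ec|ec]; first by constructor.
have [r re tr] := inv_tree iv es ec.
have md3 : md s != 3%N.
  by apply: contraNneq nu => m3; exact: (inv_fresh iv m3 es ce).
have mle : (md s <= 2)%N.
  by have := inv_md iv; rewrite leq_eqVlt (negbTE md3).
have [cr|cr] := altP (cur s =P r).
  have yr : y != r by rewrite -cr eq_sym.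
  case: ifPn => [/andP [_ m1]|_]; first by constructor.
  have py : pf s y = (e, r) := tr y ye yr.
  rewrite py cr !eqxx andbT /=.
  have -> : (md s <= 1)%N || (md s == 2) by move: mle; case: (md s) => [|[|[|]]].
  by constructor => //=; rewrite py.
have pc : pf s (cur s) = (e, r) := tr _ ce cr.
have m1 : (md s <= 1)%N.
  move: mle; rewrite leq_eqVlt => /orP [/eqP m2|//].
  by have := inv_down iv m2; rewrite pc (negbTE nu).
rewrite m1 andbT /=; case: ifPn => [_|nr]; first by constructor.
have yr : y != r by apply: contraNneq nr => ->; rewrite pc.
by rewrite (tr y ye yr) eqxx /=; constructor => //=; rewrite tr.
Qed.

Lemma charge_keep q m q' m' j g c c' : (q' + m' <= q + m)%N -> (c <= c')%N ->
  (q + m <= charge_bound j g c)%N -> (q' + m' <= charge_bound j g c')%N.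
Proof. by rewrite /charge_bound; move: (j * g)%N => t; lia. Qed.

Lemma charge_old q m m' j g c c' : (m' <= 3)%N -> (c < c')%N ->
  (q + m <= charge_bound j g c)%N -> (q.+1 + m' <= charge_bound j g c')%N.
Proof. by rewrite /charge_bound; move: (j * g)%N => t; lia. Qed.

Lemma charge_coll q m m' j g c c' : (m' <= 3)%N -> (c <= c')%N ->
  (q + m <= charge_bound j g c)%N -> (q.+1 + m' <= charge_bound j g.+1 c')%N.
Proof. by rewrite /charge_bound (mulnS j g); move: (j * g)%N => t; lia. Qed.

(** A drop of [md] is paid by growth of [nG] or [nJ], or, on a seen collision hyperedge, by that
    hyperedge newly entering [used :&: coll]. For [LF], the absence of a hit keeps the parents of
    old vertices intact. *)
Lemma inv_update b s x l : inv s -> hop d (cur s) x -> b || (x.1 \notin used s) ->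
  lab_spec b s x l -> inv (update s l x).
Proof.
case: x => e y iv hx nu; have /and4P [_ /= ny ce ye] := hx.
have [h1 h2 h3 h4 h5 h6 h7 h8 h9 h10] := iv.
have cu : (#|used s :&: coll s| <= nG s)%N.
  exact: leq_trans (subset_leq_card (subsetIr _ _)) h8.
have yve : y \in vis s :|: e by rewrite inE ye orbT.
have sve e' : e' \in seen s -> e' \subset vis s :|: e.
  by move=> /h2 /subset_trans; apply; exact: subsetUl.
have sve' e' : e' \in e |: seen s -> e' \subset vis s :|: e.
  by rewrite !inE => /orP [/eqP->|/sve //]; exact: subsetUr.
have uI : (#|used s :&: coll s| <= #|(e |: used s) :&: coll s|)%N.
  by rewrite subset_leq_card // setSI // subsetUr.
have dis : ~~ hit s (e, y) -> forall z, z \in e -> z != cur s -> z \notin vis s.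
  rewrite /hit negbK /= => /disjointFr D z ze zc; rewrite D //.
  by rewrite !inE zc ze.
case; rewrite /=.
- move=> _ ht; split=> //=.
    exact: leqW.
  rewrite set0I cards0; apply: (@charge_coll _ 4 _ _ _ 0) => //.
  exact: charge_restart cu h10.
- move=> _ /dis D; split=> //=.
    move=> _ e' e's ye'; have := D y ye; rewrite eq_sym ny => /(_ isT).
    by move/subsetP: (h2 _ e's) => ->.
  rewrite set0I cards0 subnn addn0; apply: leq_trans (charge_restart cu h10).
  by rewrite -addn1 leq_add2l.
- move=> _ es; split=> //=.
  + by rewrite setUS.
  + move=> e'; rewrite !inE; case: (e' =P e) => //= _; exact: h4.
  + by rewrite cardsU1 -add1n; apply: leq_add => //; exact: leq_b1.
  + by apply: leq_trans h9 _; rewrite subset_leq_card // subsetUr.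
  + apply: charge_coll h10 => //; rewrite subset_leq_card //.
    by rewrite setISS // subsetUr.
- move=> _ es /dis D; split=> //=.
  + exact: subset_trans h3 (subsetUr _ _).
  + move=> e'; rewrite in_setU1 => /orP [/eqP->|e's ec].
      by exists (cur s) => // z ze zc; rewrite ze zc.
    have [r re tr] := h4 _ e's ec; exists r => // z ze' zr.
    case: ifPn => [/andP [ze zc]|_]; last exact: tr.
    by have := D z ze zc; move/subsetP: (h2 _ e's) => ->.
  + move=> _ e'; rewrite !in_setU1 => /orP [->//|e's] ye'.
    have := D y ye; rewrite eq_sym ny => /(_ isT).
    by move/subsetP: (h2 _ e's) => ->.
  + by rewrite cardsU1 es add1n ltnS.
  + apply: charge_keep uI h10; move: h7; case: (md s) => [|[|[|[|]]]] //= _;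
    by rewrite ?subnn ?addn0 ?addn1 // -addn1 leq_add2l.
- move=> nb es ec yv; split=> //=.
  move: nu; rewrite (negbTE nb) /= => eu.
  apply: charge_old h10 => //; apply: proper_card; rewrite properE setSI ?subsetUr //=.
  by apply/subsetPn; exists e; rewrite !inE ?eqxx ?ec // (negbTE eu).
- move=> _ es yv m1; split=> //=.
  apply: charge_keep uI h10; move: m1; case: (md s) => [|[|]] //= _; by rewrite -addnA leq_add2l.
- move=> _ es yv py m2; split=> //=.
  + by rewrite py !inE eqxx.
  + apply: charge_keep uI h10; move: m2; case: (md s) => [|[|[|]]] //= _; by rewrite -addnA leq_add2l.
Qed.

(** What the exploration retains of self-avoidance: legal hops, and no hyperedge twice since the
    last restart or bridge. *)
Fixpoint vseq p s w : bool :=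
  match p, w with
  | i :: p', x :: w' =>
      [&& hop d (cur (prep i s)) x, is_bridge i || (x.1 \notin used (prep i s))
        & vseq p' (step i s x) w']
  | [::], [::] => true
  | _, _ => false
  end.

Lemma vseq_cat p1 p2 s w1 w2 : size p1 = size w1 ->
  vseq (p1 ++ p2) s (w1 ++ w2) = vseq p1 s w1 && vseq p2 (run p1 s w1) w2.
Proof.
elim: p1 s w1 => [|i p1 IH] s [|x w1] //= [] sz.
by rewrite IH // !andbA.
Qed.

Lemma step_spec i s x : inv s -> hop d (cur (prep i s)) x ->
  is_bridge i || (x.1 \notin used (prep i s)) ->
  lab_spec (is_bridge i) (prep i s) x (lab (is_bridge i) (prep i s) x) /\ inv (step i s x).
Proof.
move=> iv hx nu; have iv' := inv_prep i iv; split; first exact: labP.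
by rewrite /advance; exact: inv_update iv' hx nu (labP iv' hx nu).
Qed.

Lemma cur_prep i s : cur (prep i s) = cur s.
Proof. by rewrite /prep; case: ifP. Qed.

Lemma seen_prep i s : seen (prep i s) = seen s.
Proof. by rewrite /prep; case: ifP. Qed.

Lemma vis_prep i s : vis (prep i s) = vis s.
Proof. by rewrite /prep; case: ifP. Qed.

Lemma nG_prep i s : nG (prep i s) = nG s.
Proof. by rewrite /prep; case: ifP. Qed.

Lemma nJ_prep i s : nJ (prep i s) = (nJ s + i.2)%N.
Proof. by rewrite /prep; case: ifP => /= _; rewrite ?addn1 ?addn0. Qed.

Variant step_facts i s x t : Prop := StepFacts of
  inv t &
  cur t = x.2 &
  vis s :|: x.1 \subset vis t &
  seen t = (if is_bridge i then seen s else x.1 |: seen s) &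
  used t = (if is_bridge i then finset.set0 else x.1 |: used (prep i s)) &
  (nG s <= nG t)%N &
  nJ t = (nJ s + i.2 + is_bridge i)%N.

Lemma stepP i s x : inv s -> hop d (cur (prep i s)) x ->
  is_bridge i || (x.1 \notin used (prep i s)) -> step_facts i s x (step i s x).
Proof.
move=> iv hx nu; have [sp iv1] := step_spec iv hx nu.
have iv' := inv_prep i iv.
have old : x.1 \in seen (prep i s) ->
    vis (prep i s) :|: x.1 \subset vis (prep i s) /\ x.1 |: seen (prep i s) = seen (prep i s).
  move=> es; split; first by rewrite subUset subxx (inv_vis iv' es).
  by apply/setUidPr; rewrite sub1set.
case: x hx nu sp iv1 old => e y hx nu sp iv1 old; move: iv1.
rewrite /advance.
case: sp => [bb ht|bb ht|bb es|bb es ht|bb es ec yv|bb es yv m1|bb es yv py m2] iv1;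
  split => //=; rewrite ?bb ?(negbTE bb) ?vis_prep ?seen_prep ?nG_prep ?nJ_prep ?addn0 ?addn1 //.
all: by have := old es; rewrite ?vis_prep ?seen_prep => -[].
Qed.

Lemma explore_inv p s w : inv s -> vseq p s w -> inv (run p s w).
Proof.
elim: p s w => [|i p IH] s [|x w] //= iv /and3P [hx nu vs].
by apply: IH => //; case: (stepP iv hx nu).
Qed.

Lemma explore_nG p s w : inv s -> vseq p s w -> (nG s <= nG (run p s w))%N.
Proof.
elim: p s w => [|i p IH] s [|x w] //= iv /and3P [hx nu vs].
have [iv1 _ _ _ _ le1 _] := stepP iv hx nu.
exact: leq_trans le1 (IH _ _ iv1 vs).
Qed.

Lemma explore_cur p s w : inv s -> vseq p s w -> cur (run p s w) = lst (cur s) w.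
Proof.
elim: p s w => [|i p IH] s [|x w] //= iv /and3P [hx nu vs].
have [iv1 c1 _ _ _ _ _] := stepP iv hx nu.
by rewrite IH // c1 lst_cons.
Qed.

Lemma explore_vis p s w : inv s -> vseq p s w ->
  (vis s \subset vis (run p s w)) && (wvis (cur s) w \subset vis (run p s w)).
Proof.
elim: p s w => [|i p IH] s [|x w] //= iv.
  by move=> _; rewrite subxx sub1set inv_cur.
case/and3P=> hx nu vs.
have [iv1 c1 v1 _ _ _ _] := stepP iv hx nu.
have /andP [vv vw] := IH _ _ iv1 vs.
have sub := subset_trans v1 vv; move: sub; rewrite subUset => /andP [s1 s2].
rewrite s1 subUset s2 /=; apply/subsetP => z; rewrite mem_wvis => /orP [/eqP->|hz].
  by move/subsetP: s1; apply; exact: inv_cur.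
by move/subsetP: vw; apply; rewrite mem_wvis hz orbT.
Qed.

Definition njumps p : nat := (count (fun i : instr => i.2) p + count is_bridge p)%N.

Lemma explore_nJ p s w : inv s -> vseq p s w -> nJ (run p s w) = (nJ s + njumps p)%N.
Proof.
elim: p s w => [|i p IH] s [|x w] //= iv; first by rewrite addn0.
case/and3P=> hx nu vs; have [iv1 _ _ _ _ _ j1] := stepP iv hx nu.
by rewrite IH // j1 /njumps /=; lia.
Qed.

(** This identifies the product left by the moment bound with the probability [PS] tracked along the
    exploration. *)
Lemma explore_seen p s w : inv s -> vseq p s w ->
  seen (run p s w) = seen s :|: nbset (unzip1 p) (unzip1 w).
Proof.
elim: p s w => [|i p IH] s [|x w] //= iv.
  by move=> _; apply/setP => e; rewrite !inE orbF.
case/and3P=> hx nu vs; have [iv1 _ _ s1 _ _ _] := stepP iv hx nu.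
rewrite IH // s1; apply/setP => e; rewrite /is_bridge !inE /kof /= [x.1 == e]eq_sym.
by case E: (e == x.1); case B: (i.1 == None); rewrite /= ?inE ?E ?B /= ?orbT.
Qed.

(** * Probability of the explored hyperedges against the kernel weight *)

Section Weights.
Variables (R : realType) (a b theta Theta alp : R).
Hypothesis b0 : 0 < b.
Hypothesis ba : b <= a.
Hypothesis n0 : (0 < n)%N.
Hypothesis alp0 : 0 < alp.
Hypothesis Th0 : 0 < Theta.
Hypothesis thTh : theta * Theta = 1.
Notation pa := (pn d a n).
Notation pbar := (pbar n d a b).
Notation phi := (step_weight d pa pbar theta alp).
Notation Phi := (run_weight d pa pbar theta alp).

(* The ratio between the true weight of an exploration and its kernel weight. *)
Definition credit s : R := Theta ^+ nQ s * alp ^+ nF s / n%:R ^+ nG s.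

Lemma balance_hit (K p t T A x N : R) : x != 0 -> N != 0 ->
  K * p * (t * T * A / N) = K * (x * p * t) * (T * A / (x * N)).
Proof. by move=> x0 N0; field; rewrite x0 N0. Qed.

Lemma balance_fresh (K p t T A x N : R) : x != 0 -> N != 0 ->
  K * p * 1 * (t * T * A / N) = K * (p / x * t) * (T * (x * A) / N).
Proof. by move=> x0 N0; field; rewrite x0 N0. Qed.

Lemma balance_old (K p t T A N : R) : N != 0 ->
  K * p * (t * T * A / N) = K * (p * t) * (T * A / N).
Proof. by move=> N0; field; rewrite N0. Qed.

Lemma credit_gt0 s : 0 < credit s.
Proof. by rewrite /credit divr_gt0 ?mulr_gt0 ?exprn_gt0 ?ltr0n. Qed.

Lemma credit_prep i s : credit (prep i s) = credit s.
Proof. by rewrite /prep; case: ifP. Qed.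

Lemma pa_ge0 : 0 <= pa.
Proof. by apply: pn_ge0; exact: a_ge0 b0 ba. Qed.

Lemma charge_cancel (c : bool) q : (if c then theta else 1) * Theta ^+ (q + c) = Theta ^+ q.
Proof.
case: c; rewrite ?addn1 ?addn0 ?mul1r //.
by rewrite exprS mulrA thTh mul1r.
Qed.

Lemma PS_step i s x : inv s -> hop d (cur (prep i s)) x ->
  is_bridge i || (x.1 \notin used (prep i s)) ->
  PS d a b (seen (step i s x)) * (if is_bridge i then pa else 1) * credit s <=
  PS d a b (seen s) * phi (is_bridge i) (prep i s) x * credit (step i s x).
Proof.
move=> iv hx nu; have [sp _] := step_spec iv hx nu.
rewrite -(credit_prep i) -(seen_prep i s); have := inv_prep i iv.
rewrite /step /step_weight; set s' := prep i s in hx nu sp *; move=> iv'.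
set K := PS d a b (seen s').
have K0 : 0 <= K by apply: PS_ge0.
have thT q : theta * Theta ^+ q.+1 = Theta ^+ q by rewrite exprS mulrA thTh mul1r.
have nn0 : n%:R != 0 :> R by rewrite pnatr_eq0 -lt0n.
have n0q q : n%:R ^+ q != 0 :> R by rewrite expf_neq0.
case: x hx nu sp => e y hx nu; have /and4P [/eqP /= ed _ ce ye] := hx.
have S1 : e \notin seen s' -> PS d a b (e |: seen s') <= K * pa.
  by move=> es; apply: PS_setU1 => //.
have S2 : e \notin seen s' -> ~~ hit s' (e, y) -> PS d a b (e |: seen s') = K * pbar.
  move=> es; rewrite /hit negbK /= => D; apply: PS_fresh ed ce es _.
  by move=> e' /(inv_vis iv') es'; exact: disjointWr es' D.
have V0 : 0 <= credit s' := ltW (credit_gt0 s').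
have vE : credit s' = Theta ^+ nQ s' * alp ^+ nF s' / n%:R ^+ nG s' by [].
have an0 : alp != 0 by rewrite gt_eqF.
have cK c := charge_cancel c (nQ s').
case=> [bi ht|bi ht|bi es|bi es ht|bi es ec yv|bi es yv m1|bi es yv py m2];
  rewrite ?bi ?(negbTE bi) /=.
- by rewrite vE /credit /= -/K -(thT (nQ s')) (exprS _ (nG s')) (balance_hit _ _ _ _ _ nn0 (n0q _)).
- by rewrite vE /credit /= -/K -(thT (nQ s')) (balance_old _ _ _ _ _ (n0q _)).
- apply: (@le_trans _ _ (K * pa * credit s')); first by rewrite mulr1 ler_wpM2r // S1.
  by rewrite vE /credit /= -(thT (nQ s')) (exprS _ (nG s')) (balance_hit _ _ _ _ _ nn0 (n0q _)).
- by rewrite (S2 es ht) vE /credit /= -(cK (md s' != 3%N)) (exprS _ (nF s')) (balance_fresh _ _ _ _ _ an0 (n0q _)).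
- by rewrite vE /credit /= -/K -(thT (nQ s')) (balance_old _ _ _ _ _ (n0q _)).
- by rewrite vE /credit /= -/K -(cK (md s' != 1%N)) (balance_old _ _ _ _ _ (n0q _)).
- by rewrite vE /credit /= -/K -(cK (md s' != 2%N)) (balance_old _ _ _ _ _ (n0q _)).
Qed.

Lemma PS_explore p s w : inv s -> vseq p s w ->
  PS d a b (seen (run p s w)) * pa ^+ count is_bridge p * credit s <=
  PS d a b (seen s) * Phi p s w * credit (run p s w).
Proof.
elim: p s w => [|i p IH] s [|x w] //= iv.
case/and3P=> hx nu vs; have [iv1 _ _ _ _ _ _] := stepP iv hx nu.
have h1 := PS_step iv hx nu; have h2 := IH _ _ iv1 vs.
set s1 := step i s x in iv1 vs h1 h2 *; set sf := run p s1 w in h2 *.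
have v1 := credit_gt0 s1; have vf := ltW (credit_gt0 sf); have v0 := ltW (credit_gt0 s).
rewrite -(ler_pM2r v1) exprD.
have k0 : 0 <= (if is_bridge i then pa else 1) by case: ifP => // _; exact: pa_ge0.
have -> : pa ^+ (is_bridge i) = (if is_bridge i then pa else 1) by case: (is_bridge i).
set k := if _ then _ else _ in h1 k0 *.
have P0 : 0 <= Phi p s1 w.
  by apply: run_weight_ge0 => //; [exact: pa_ge0 | exact: pbar_ge0 | rewrite -(pmulr_lge0 _ Th0) thTh].
apply: (@le_trans _ _ ((PS d a b (seen s1) * k * credit s) * (Phi p s1 w * credit sf))).
  rewrite [X in X <= _](_ : _ = (PS d a b (seen sf) * pa ^+ count is_bridge p * credit s1) * (k * credit s)); last by ring.
  rewrite [X in _ <= X](_ : _ = (PS d a b (seen s1) * Phi p s1 w * credit sf) * (k * credit s)); last by ring.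
  by rewrite ler_wpM2r // mulr_ge0.
rewrite [X in _ <= X](_ : _ = (PS d a b (seen s) * phi (is_bridge i) (prep i s) x * credit s1) * (Phi p s1 w * credit sf)); last by ring.
by rewrite ler_wpM2r // mulr_ge0.
Qed.
End Weights.

(** * Legality of the chains and collisions they force *)

Lemma count_is_bridge_plain (ks : seq kind) : bri \notin ks -> count is_bridge [seq (k, false) | k <- ks] = 0%N.
Proof.
elim: ks => //= k ks IH; rewrite inE negb_or eq_sym => /andP [/negbTE nk /IH ->].
by rewrite /is_bridge /= nk.
Qed.

Definition plain (ks : seq kind) : seq instr := [seq (k, false) | k <- ks].

Lemma saw_edge_fresh i x w : saw d i (x :: w) -> forall x', x' \in w -> x'.1 != x.1.
Proof.
move=> /= /and3P [/and4P [_ ny ix _] _ /eqP/setP hE] x' xw.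
apply: contraNneq ny => ex; have := hE i; rewrite !inE ix /= => <-.
by rewrite mem_wvis; apply/orP; right; apply/hasP; exists x'; rewrite ?ex.
Qed.

Lemma saw_vseq ks s w : bri \notin ks -> size ks = size w -> inv s ->
  saw d (cur s) w -> (forall x, x \in w -> x.1 \notin used s) -> vseq (plain ks) s w.
Proof.
elim: ks s w => [|k ks IH] s [|x w] //; rewrite inE negb_or => /andP [nk nks] [] sz iv sw nu.
have ib : is_bridge (k, false) = false by rewrite /is_bridge /= eq_sym (negbTE nk).
have /= /and3P [hx sw' _] := sw.
have nx : is_bridge (k, false) || (x.1 \notin used (prep (k, false) s)) by rewrite nu ?mem_head ?orbT.
have [iv1 c1 _ _ u1 _ _] := stepP (i := (k, false)) iv hx nx.
rewrite /= hx nx /=; apply: IH => //; first by rewrite c1.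
move=> x' xw; rewrite u1 ib /= !inE negb_or (saw_edge_fresh sw xw) nu //.
by rewrite inE xw orbT.
Qed.

Lemma saw_vseq_start ks s w : bri \notin ks -> size ks = size w -> inv s ->
  saw d (cur s) w -> vseq (mkprog ks) s w.
Proof.
case: ks => [|k ks] //; first by case: w.
move=> nk sz iv sw.
have vs : vseq (plain (k :: ks)) (restart s) w.
  by apply: saw_vseq => //; [exact: inv_restart | move=> x _; rewrite inE].
by case: w sz sw vs.
Qed.

(* From an isolated vertex every hyperedge is new, so a walk that gains no factor
   1/n stays in fresh vertices. *)
Lemma fresh_walk ks s w : bri \notin ks -> inv s -> md s = 3 -> vseq (plain ks) s w ->
  nG (run (plain ks) s w) = nG s ->
  forall z, z \in wvis (cur s) w -> z != cur s -> z \notin vis s.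
Proof.
elim: ks s w => [|k ks IH] s [|x w] //.
  by move=> _ _ _ _ _ z; rewrite inE => ->.
rewrite inE negb_or => /andP [nk nks] iv m3 /= /and3P [hx nu vs].
have ib : is_bridge (k, false) = false by rewrite /is_bridge /= eq_sym (negbTE nk).
have [iv1 c1 v1 _ _ _ _] := stepP (i := (k, false)) iv hx nu.
have := explore_nG iv1 vs; have := IH (step (k, false) s x) w nks iv1; move: vs.
have := labP iv hx nu; rewrite /advance /prep /= ib.
case: x hx nu c1 v1 iv1 => e y hx nu c1 v1 iv1.
have old : e \in seen s -> False.
  move=> es; have /and4P [_ _ /= ce _] := hx.
  by move: nu; rewrite ib /= (inv_fresh iv m3 es ce).
case=> //=; try by move=> _ /old.
  by move=> _ _ vs _ h eqG; rewrite eqG ltnn in h.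
move=> _ es; rewrite /hit negbK /= => D vs /(_ (erefl _) vs) h _ /h {}h z.
have /and4P [_ /= ny ce ye] := hx.
have De z' : z' \in e -> z' != cur s -> z' \notin vis s.
  by move=> ze zc; rewrite (disjointFr D) // !inE zc.
move=> zw zc; have [->|zy] := eqVneq z y; first by apply: De => //; rewrite eq_sym.
have : (z \in e) || (z \in wvis y w).
  by move: zw; rewrite inE !mem_wvis (negbTE zc) /= => /orP [->|->]; rewrite ?orbT.
case/orP=> [ze|zw']; first exact: De.
by have := h z zw' zy; rewrite inE negb_or => /andP [].
Qed.

(** Uniformity in the state makes gains add up along products of copies ([gain_cat]). *)
Definition gain (c : copy n) g := forall s w, inv s -> size w = csize c ->
  cval c (cur s) w ->
  vseq (cprog c) s w /\ (nG s + g <= nG (run (cprog c) s w))%N.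

Lemma gain_nil : gain (nil_copy n) 0.
Proof. by move=> s w iv /size0nil -> _; rewrite addn0. Qed.

Lemma gain_walk k l : k != bri -> gain (walk_copy n d k l) 0.
Proof.
move=> nk s w iv; rewrite /csize /= size_mkprog size_nseq => sw sa.
have vs : vseq (mkprog (nseq l k)) s w.
  by apply: saw_vseq_start; rewrite ?size_nseq // mem_nseq eq_sym (negbTE nk) andbF.
by split=> //; rewrite addn0; exact: explore_nG.
Qed.

Lemma gain_cat c1 c2 g1 g2 : gain c1 g1 -> gain c2 g2 ->
  gain (cat_copy c1 c2) (g1 + g2).
Proof.
move=> h1 h2 s w iv; rewrite /csize /= size_cat => sw /andP [v1 v2].
set u := take (csize c1) w in v1 v2; set v := drop (csize c1) w in v2.
have su : size u = size (cprog c1) by rewrite size_takel // sw leq_addr.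
have sv : size v = csize c2 by rewrite size_drop sw addKn.
have [vs1 gg1] := h1 s u iv su v1.
have iv1 := explore_inv iv vs1; rewrite -(explore_cur iv vs1) in v2.
have [vs2 gg2] := h2 _ v iv1 sv v2.
rewrite -[w](cat_take_drop (csize c1)) vseq_cat // vs1 explore_cat //; split=> //.
by apply: leq_trans gg2; rewrite addnA leq_add2r.
Qed.

(** By contradiction: without a collision the bridge ends at an isolated vertex and [fresh_walk]
    keeps the second walk away from everything seen, so by [saw_cat] the whole word would be
    self-avoiding. *)
Lemma gain_gap ka l1 kb l2 : ka != bri -> kb != bri -> gain (gap_copy n d ka l1 kb l2) 1.
Proof.
move=> na nb s w iv; rewrite /csize /= size_cat size_mkprog size_nseq /= size_map size_nseq => sw.
case/andP=> /andP [su +] nsaw; case E: (drop l1 w) => [|x v] // /andP [hx sv].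
set u := take l1 w in su hx; have szu : size u = l1 by rewrite size_takel // sw leq_addr.
have szv : size v = l2 by have := size_drop l1 w; rewrite E /= sw; lia.
have wE : w = u ++ x :: v by rewrite -E cat_take_drop.
have nka : bri \notin nseq l1 ka by rewrite mem_nseq eq_sym (negbTE na) andbF.
have nkb : bri \notin nseq l2 kb by rewrite mem_nseq eq_sym (negbTE nb) andbF.
have vs1 : vseq (mkprog (nseq l1 ka)) s u.
  by apply: saw_vseq_start; rewrite ?size_nseq.
have szm : size (mkprog (nseq l1 ka)) = size u by rewrite size_mkprog size_nseq.
have iv1 := explore_inv iv vs1; have c1 := explore_cur iv vs1; have g1 := explore_nG iv vs1.
rewrite {1 2}wE vseq_cat // vs1 explore_cat //.
set s1 := run _ s u in iv1 c1 g1 *.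
have hx1 : hop d (cur (prep (bri, true) s1)) x by rewrite cur_prep c1.
have [iv2 c2 v2 _ u2 g2 _] := stepP (i := (bri, true)) iv1 hx1 isT.
have vs2 : vseq (plain (nseq l2 kb)) (step (bri, true) s1 x) v.
  apply: saw_vseq => //; rewrite ?size_nseq ?c2 // => z _.
  by rewrite u2 /= inE.
rewrite /= in hx1 *; rewrite hx1 -/(plain _) vs2; split=> //.
have g3 := explore_nG iv2 vs2; rewrite addn1.
apply: leq_ltn_trans g1 _.
rewrite ltnNge; apply/negP => gle.
have e2 : nG (step (bri, true) s1 x) = nG s1.
  by apply/eqP; rewrite eqn_leq g2 andbT; exact: leq_trans g3 gle.
have e3 : nG (run (plain (nseq l2 kb)) (step (bri, true) s1 x) v) = nG (step (bri, true) s1 x).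
  by apply/eqP; rewrite eqn_leq g3 andbT e2.
(* The bridge gained nothing, so it carries the label [LBf]. *)
have [nh m3] : ~~ hit s1 x /\ md (step (bri, true) s1 x) = 3.
  have sp := labP (b := true) (inv_prep (bri, true) iv1) hx1 isT.
  move: e2; rewrite /advance (_ : is_bridge (bri, true) = true) //.
  case: x {E wE hx hx1 sv c2 v2 u2 g2 iv2 vs2 g3 gle e3} sp => e y [] //=.
  by move=> _ _ /eqP; rewrite eqn_leq ltnn.
have fw := fresh_walk nkb iv2 m3 vs2 e3; rewrite c2 in fw.
move/negP: nsaw; apply; rewrite wE saw_cat su /= hx sv /=.
have /and4P [_ ny ix yx] := hx; rewrite -c1 in hx ix ny *.
have vsub := explore_vis iv vs1; rewrite -/s1 in vsub; have /andP [_ uv] := vsub.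
have cv1 := inv_cur iv1.
move: v2; rewrite subUset => /andP [v2 v2'].
have Dx z : z \in x.1 -> z != cur s1 -> z \notin vis s1.
  move=> zx zc; move: nh; rewrite /hit negbK => D.
  by rewrite (disjointFr D) // !inE zc.
apply/andP; split; apply/eqP/setP => z; rewrite !inE.
  apply/andP/eqP => [[zx zw]|->]; last by rewrite wvis_start.
  apply/eqP; apply: contraT => zy; have := fw z zw zy.
  by move/subsetP: v2' => /(_ z zx) ->.
apply/andP/eqP => [[zu zw]|->]; last first.
  by rewrite ix /= c1 (lst_wvis su).
apply/eqP; apply: contraT => zc; move/subsetP: uv => /(_ z zu) zv1.
have nzx : z \notin x.1 by apply: contraL zv1 => zx; exact: Dx.
move: zw; rewrite (negbTE nzx) /= mem_wvis (negbTE zc) /= => hz.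
have zy : z != x.2 by apply: contraNneq nzx => ->.
have := fw z _ zy; rewrite mem_wvis hz orbT => /(_ isT).
by move/subsetP: v2 => /(_ z zv1) ->.
Qed.
End Invariants.

(** * Expected traces *)

Section TraceBound.
Variables (R : realType) (n d : nat) (a b theta Theta delta C1 : R) (V : nat).
Notation X := ({set 'I_n} * 'I_n)%type.
Notation pa := (pn d a n).
Notation pbar := (pbar n d a b).
Notation alp := (alpha d a b).
Hypothesis d1 : (1 < d)%N.
Hypothesis b0 : 0 < b.
Hypothesis ba : b <= a.
Hypothesis alp1 : 1 <= alp.
Hypothesis n0 : (0 < n)%N.
Hypothesis C1E : C1 = (d ^ 2)%:R * a.
Hypothesis Th1 : 1 <= Theta.
Hypothesis thTh : theta * Theta = 1.
Hypothesis thetaR : theta * (2 + C1 + (V * V)%:R + C1 * V%:R + (d * V)%:R) <= delta.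

Definition init_state (i : 'I_n) : state n :=
  State i [set i] finset.set0 finset.set0 finset.set0 (fun z => (finset.set0, z)) 0 0 0 0 0.

Lemma inv_init_state i : inv (init_state i).
Proof.
split => //=; rewrite ?inE ?cards0 ?setI0 //.
- by move=> e; rewrite inE.
- by move=> e; rewrite inE.
Qed.

Definition expectation (f : spins n -> hgraph n -> R) : R :=
  \sum_(s : spins n) \sum_(H : hgraph n | H \subset dsets d n) weight d a b s H * f s H.

Lemma vseq_dsets p (s : state n) (w : seq X) :
  vseq d p s w -> all (fun e : {set 'I_n} => #|e| == d) (unzip1 w).
Proof.
elim: p s w => [|i p IH] s [|x w] //= /and3P [/and4P [-> _ _ _] _ vs] /=.
exact: IH vs.
Qed.

Lemma count_is_bridge (p : seq instr) : count is_bridge p = count_mem bri (unzip1 p).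
Proof. by rewrite /unzip1 count_map. Qed.

Lemma alp_gt0 : 0 < alp. Proof. exact: lt_le_trans ltr01 alp1. Qed.
Lemma Theta_gt0 : 0 < Theta. Proof. exact: lt_le_trans ltr01 Th1. Qed.
Lemma theta_ge0 : 0 <= theta. Proof. by rewrite -(pmulr_lge0 _ Theta_gt0) thTh. Qed.

Lemma run_weight_init_sum p i : (1 + d * size p <= V)%N -> (size p <= V)%N ->
  \sum_(w : (size p).-tuple X) run_weight d pa pbar theta alp p (init_state i) w <= (1 + delta) ^+ size p.
Proof.
move=> h1 h2; rewrite -[X in _ <= X]mul1r.
have pa0 : 0 <= pa by apply: pn_ge0; exact: (a_ge0 b0 ba).
have C10 : 0 <= C1 by rewrite C1E mulr_ge0 // (a_ge0 b0 ba).
have freeR : (d.-1 * 'C(n.-1, d.-1))%:R * pa <= C1.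
  rewrite C1E natrM -mulrA.
  apply: (@le_trans _ _ ((d ^ 2)%:R * (pa * 'C(n, d.-1)%:R))); last first.
    by rewrite ler_wpM2l // pn_mul_bin // (a_ge0 b0 ba).
  rewrite ler_pM ?mulr_ge0 // ?ler_nat; last first.
    by rewrite mulrC ler_wpM2l // ler_nat leq_bin2l // leq_pred.
  by rewrite expnS expn1; apply: leq_trans (leq_pred _) _; rewrite leq_pmulr //; lia.
have hitR : d.-1%:R * (n%:R * pa * 'C(n - 2, d - 2)%:R) <= C1.
  apply: (@le_trans _ _ ((d.-1)%:R * ((d.-1)%:R * a))).
    by rewrite ler_wpM2l // (hit_rate b0 ba).
  by rewrite C1E mulrA -natrM ler_wpM2r ?(a_ge0 b0 ba) // ler_nat expnS expn1 leq_mul // leq_pred.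
have := @run_weight_sum n d R pa pbar theta alp C1 delta V pa0 (pbar_ge0 n d b0 ba) alp_gt0
  theta_ge0 C10 (fresh_rate d b0 ba n0) freeR hitR thetaR p (init_state i).
by apply; rewrite /= ?inE ?cards1 ?cards0.
Qed.

Lemma bound_ge0 J g F :
  0 <= Theta ^+ (4 + 4 * J) * (Theta ^+ (8 + 4 * J) / n%:R) ^+ g * alp ^+ F.
Proof.
have T0 := ltW Theta_gt0; have A0 := ltW alp_gt0.
have q0 : 0 <= Theta ^+ (8 + 4 * J) / n%:R by rewrite divr_ge0 ?exprn_ge0.
by apply: mulr_ge0; [apply: mulr_ge0|]; apply: exprn_ge0.
Qed.

(** With c <= G, the bound 4 + 4J + 4G + 4(JG + c) is at most (4 + 4J) + (8 + 4J)G. As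
    Theta^(8+4J)/n <= 1, its exponent G may be lowered to g. *)
Lemma credit_le (s : state n) g J F : inv s -> (nJ s <= J)%N -> (g <= nG s)%N -> (nF s <= F)%N ->
  Theta ^+ (8 + 4 * J) <= n%:R ->
  credit Theta alp s <= Theta ^+ (4 + 4 * J) * (Theta ^+ (8 + 4 * J) / n%:R) ^+ g * alp ^+ F.
Proof.
move=> iv jJ gG fF TJ.
have Q : (nQ s <= (4 + 4 * J) + (8 + 4 * J) * nG s)%N.
  have cu : (#|used s :&: coll s| <= nG s)%N.
    exact: leq_trans (subset_leq_card (subsetIr _ _)) (inv_nG iv).
  have := leq_trans (leq_addr _ _) (inv_nQ iv); rewrite /charge_bound => h.
  apply: (leq_trans h); clear h.
  have : (nJ s * nG s <= J * nG s)%N by rewrite leq_mul2r jJ orbT.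
  rewrite mulnDl -mulnA; lia.
have n0' : 0 < n%:R :> R by rewrite ltr0n.
rewrite /credit mulrAC; apply: ler_pM.
- by rewrite divr_ge0 // exprn_ge0 // ltW // Theta_gt0.
- by rewrite exprn_ge0 // ltW // alp_gt0.
- apply: (@le_trans _ _ (Theta ^+ (4 + 4 * J + (8 + 4 * J) * nG s) / n%:R ^+ nG s)).
    by rewrite ler_wpM2r ?invr_ge0 ?exprn_ge0 // ler_weXn2l.
  rewrite exprD exprM -mulrA -expr_div_n ler_wpM2l ?exprn_ge0 // ?(ltW Theta_gt0) //.
  by rewrite ler_wiXn2l // ?divr_ge0 ?exprn_ge0 ?(ltW Theta_gt0) // ler_pdivrMr // mul1r.
- by rewrite ler_weXn2l.
Qed.

Lemma expect_gpr_le (c : copy n) g J F i w :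
  gain d c g -> (njumps (cprog c) <= J)%N ->
  (count_mem cen (ckinds c) + (count_mem non (ckinds c)).*2 <= F.*2)%N ->
  Theta ^+ (8 + 4 * J) <= n%:R ->
  size w = csize c -> cval c i w ->
  `|expectation (fun s H => gpr d a b s H (ckinds c) (unzip1 w))| <=
  run_weight d pa pbar theta alp (cprog c) (init_state i) w *
    (Theta ^+ (4 + 4 * J) * (Theta ^+ (8 + 4 * J) / n%:R) ^+ g * alp ^+ F).
Proof.
move=> gc jJ cF TJ sw cv.
have [vs gg] := gc (init_state i) w (inv_init_state i) sw cv.
have iv := explore_inv (inv_init_state i) vs.
have pa0 : 0 <= pa by apply: pn_ge0; exact: (a_ge0 b0 ba).
have szk : size (ckinds c) = size (unzip1 w) by rewrite !size_map sw.
have P0 : 0 <= run_weight d pa pbar theta alp (cprog c) (init_state i) w.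
  apply: run_weight_ge0 => //; [exact: pbar_ge0 | exact: alp_gt0 | exact: theta_ge0].
have B0 : 0 <= Theta ^+ (4 + 4 * J) * (Theta ^+ (8 + 4 * J) / n%:R) ^+ g * alp ^+ F.
  exact: bound_ge0.
apply: (@le_trans _ _ (pa ^+ count_mem bri (ckinds c) *
   (if covered (ckinds c) (unzip1 w) then PS d a b (nbset (ckinds c) (unzip1 w)) else 0))).
  rewrite /expectation; apply: (le_trans (ler_norm_sum _ _ _)).
  apply: (@le_trans _ _ (\sum_(s : spins n) 2 ^- n * (pa ^+ count_mem bri (ckinds c) *
    (if covered (ckinds c) (unzip1 w) then
       \prod_(e in nbset (ckinds c) (unzip1 w)) edge_prob d a b s e else 0)))).
    by apply: ler_sum => s _; apply: expect_gpr => //; exact: vseq_dsets vs.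
  case: ifP => _; last by rewrite !mulr0 big1 // => s _; rewrite !mulr0.
  by rewrite /PS mulr_sumr; apply: ler_sum => s _; rewrite mulrCA.
case: ifPn => [cov|_]; last by rewrite mulr0 mulr_ge0.
have := PS_explore b0 ba n0 alp_gt0 Theta_gt0 thTh (inv_init_state i) vs.
rewrite (explore_seen (inv_init_state i) vs) /= set0U PS_set0 /credit /= !expr0 !mulr1 invr1 mulr1 mul1r.
rewrite mulr1 count_is_bridge -/(ckinds c) [X in X <= _]mulrC => h; apply: (le_trans h).
rewrite ler_wpM2l //; apply: credit_le => //.
- by rewrite (explore_nJ (inv_init_state i) vs).
(* Fresh hyperedges are among the seen ones, each of which uses two units of the weighted count. *)
- apply: (leq_trans (inv_nF iv)); rewrite (explore_seen (inv_init_state i) vs) /= set0U.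
  by rewrite -leq_double; apply: leq_trans cF; exact: covered_card.
Qed.

Lemma expectation_sum (I : Type) (r : seq I) (P : pred I) (f : I -> spins n -> hgraph n -> R) :
  expectation (fun s H => \sum_(i <- r | P i) f i s H) = \sum_(i <- r | P i) expectation (f i).
Proof.
rewrite /expectation [RHS]exchange_big /=; apply: eq_bigr => s _.
rewrite [RHS]exchange_big /=; apply: eq_bigr => H _.
by rewrite mulr_sumr.
Qed.

Lemma expectationZ k (f : spins n -> hgraph n -> R) : expectation (fun s H => k * f s H) = k * expectation f.
Proof.
rewrite /expectation mulr_sumr; apply: eq_bigr => s _; rewrite mulr_sumr.
by apply: eq_bigr => H _; rewrite mulrCA.
Qed.

Lemma eq_expectation (f g : spins n -> hgraph n -> R) : (forall s H, f s H = g s H) -> expectation f = expectation g.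
Proof.
by move=> fg; rewrite /expectation; apply: eq_bigr => s _; apply: eq_bigr => H _; rewrite fg.
Qed.

(** The factor n counts starting vertices; the condition that the word closes up is bounded by
    one. *)
Theorem expected_trace (c : copy n) g J F :
  gain d c g -> (njumps (cprog c) <= J)%N ->
  (count_mem cen (ckinds c) + (count_mem non (ckinds c)).*2 <= F.*2)%N ->
  Theta ^+ (8 + 4 * J) <= n%:R ->
  (1 + d * csize c <= V)%N -> (csize c <= V)%N ->
  expectation (fun s H => \tr (mcopy d a b s H c)) <=
  n%:R * (1 + delta) ^+ csize c *
    (Theta ^+ (4 + 4 * J) * (Theta ^+ (8 + 4 * J) / n%:R) ^+ g * alp ^+ F).
Proof.
move=> gc jJ cF TJ V1 V2.
set B := Theta ^+ (4 + 4 * J) * _ * _.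
have B0 : 0 <= B.
  exact: bound_ge0.
pose f i (w : (csize c).-tuple X) s H : R :=
  ((lst i w == i)%:R * (cval c i w)%:R) * gpr d a b s H (ckinds c) (unzip1 w).
rewrite (@eq_expectation _ (fun s H => \sum_i \sum_w f i w s H)); last first.
  move=> s H; rewrite /mxtrace; apply: eq_bigr => i _; rewrite mxE.
  by apply: eq_bigr => w _; rewrite /f mulrA.
rewrite expectation_sum.
apply: (@le_trans _ _ (\sum_(i < n) (1 + delta) ^+ csize c * B)); last first.
  by rewrite sumr_const card_ord -[X in X <= _]mulr_natl mulrA.
apply: ler_sum => i _; rewrite expectation_sum.
apply: (le_trans _ (ler_wpM2r B0 (run_weight_init_sum i V1 V2))).
rewrite mulr_suml; apply: ler_sum => w _; rewrite /f expectationZ.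
have P0 : 0 <= run_weight d pa pbar theta alp (cprog c) (init_state i) w.
  apply: run_weight_ge0; [apply: pn_ge0; exact: (a_ge0 b0 ba) | exact: pbar_ge0 | exact: alp_gt0 | exact: theta_ge0].
case: (boolP (cval c i w)) => cv; last by rewrite mulr0 mul0r mulr_ge0.
rewrite mulr1; have := @expect_gpr_le c g J F i w gc jJ cF TJ (size_tuple w) cv.
case: (_ == _); rewrite ?mul0r ?mul1r => h; last by rewrite mulr_ge0.
exact: le_trans (ler_norm _) h.
Qed.
End TraceBound.

(** * Parameters of powers of a copy *)

Section PowerCopies.
Variables (n d : nat).

Definition pow_copy (c : copy n) k : copy n := iter k (cat_copy c) (nil_copy n).

Definition mxpow (R : realType) (P : 'M[R]_n) k : 'M[R]_n := iter k (mulmx P) 1%:M.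

Lemma mcopy_pow (R : realType) (a b : R) s H c k :
  mcopy d a b s H (pow_copy c k) = mxpow (mcopy d a b s H c) k.
Proof.
by elim: k => [|k IH]; rewrite /= ?mcopy_nil // mcopy_cat IH.
Qed.

Lemma gain_pow c g k : gain d c g -> gain d (pow_copy c k) (k * g).
Proof.
by move=> gc; elim: k => [|k IH]; [exact: gain_nil | rewrite mulSn; exact: gain_cat].
Qed.

Lemma csize_cat (c1 c2 : copy n) : csize (cat_copy c1 c2) = (csize c1 + csize c2)%N.
Proof. by rewrite /csize size_cat. Qed.

Lemma csize_pow c k : csize (pow_copy c k) = (k * csize c)%N.
Proof. by elim: k => [|k IH] //=; rewrite csize_cat IH mulSn. Qed.

Lemma njumps_cat p1 p2 : njumps (p1 ++ p2) = (njumps p1 + njumps p2)%N.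
Proof. by rewrite /njumps !count_cat; lia. Qed.

Lemma njumps_pow c k : njumps (cprog (pow_copy c k)) = (k * njumps (cprog c))%N.
Proof. by elim: k => [|k IH] //=; rewrite njumps_cat IH mulSn. Qed.

Lemma count_ckinds_cat x (c1 c2 : copy n) :
  count_mem x (ckinds (cat_copy c1 c2)) = (count_mem x (ckinds c1) + count_mem x (ckinds c2))%N.
Proof. by rewrite /ckinds /unzip1 map_cat count_cat. Qed.

Lemma count_ckinds_pow x c k :
  count_mem x (ckinds (pow_copy c k)) = (k * count_mem x (ckinds c))%N.
Proof. by elim: k => [|k IH] //=; rewrite count_ckinds_cat IH mulSn. Qed.

Lemma njumps_mkprog (ks : seq kind) : bri \notin ks -> (njumps (mkprog ks) <= 1)%N.
Proof.
case: ks => [|k ks] //; rewrite inE negb_or eq_sym => /andP [/negbTE nk nks].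
have ib : is_bridge (k, true) = false by exact: nk.
rewrite /njumps /= ib count_is_bridge_plain // count_map.
by rewrite (eq_count (a2 := pred0)) // count_pred0.
Qed.

Lemma njumps_walk k l : k != bri -> (njumps (cprog (walk_copy n d k l)) <= 1)%N.
Proof. by move=> nk; apply: njumps_mkprog; rewrite mem_nseq eq_sym (negbTE nk) andbF. Qed.

(** One jump for the start of the first walk, two for the bridge, which also carries a restart
    flag. *)
Lemma njumps_gap ka l1 kb l2 : ka != bri -> kb != bri ->
  (njumps (cprog (gap_copy n d ka l1 kb l2)) <= 3)%N.
Proof.
move=> na nb; rewrite /= njumps_cat.
have h : (njumps (mkprog (nseq l1 ka)) <= 1)%N.
  by apply: njumps_mkprog; rewrite mem_nseq eq_sym (negbTE na) andbF.
rewrite -(addn1 2) addnC; apply: leq_add => //.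
rewrite /njumps /= count_is_bridge_plain; last by rewrite mem_nseq eq_sym (negbTE nb) andbF.
by rewrite count_map (eq_count (a2 := pred0)) // count_pred0.
Qed.

Lemma csize_walk k l : csize (walk_copy n d k l) = l.
Proof. by rewrite /csize /= size_mkprog size_nseq. Qed.

Lemma csize_gap ka l1 kb l2 : csize (gap_copy n d ka l1 kb l2) = (l1 + l2.+1)%N.
Proof. by rewrite /csize /= size_cat size_mkprog /= size_map !size_nseq. Qed.

Lemma count_walk x k l : count_mem x (ckinds (walk_copy n d k l)) = ((k == x) * l)%N.
Proof. by rewrite /ckinds /= mkprogE count_nseq. Qed.

Lemma count_gap x ka l1 kb l2 : x != bri ->
  count_mem x (ckinds (gap_copy n d ka l1 kb l2)) = ((ka == x) * l1 + (kb == x) * l2)%N.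
Proof.
move=> nx; rewrite /ckinds /= /unzip1 map_cat -/(unzip1 _) mkprogE /= count_cat /=.
by rewrite -/(unzip1 _) unzip1_pairf !count_nseq eq_sym (negbTE nx).
Qed.
End PowerCopies.

(** * From traces to spectral norms *)

Section Spectral.
Variables (R : realType) (n : nat).
Implicit Types (x y : 'cV[R]_n) (A P Q M : 'M[R]_n).

Definition dot x y : R := \sum_k x k ord0 * y k ord0.

Lemma dot_mulmx x y A : dot x (A *m y) = dot (A^T *m x) y.
Proof.
rewrite /dot; under eq_bigr => k _ do rewrite mxE mulr_sumr.
rewrite exchange_big /=; apply: eq_bigr => j _.
by rewrite mxE mulr_suml; apply: eq_bigr => k _; rewrite !mxE mulrCA mulrA.
Qed.

(** Lagrange's identity: the sum of all (u_i v_j - u_j v_i)^2 is twice the difference of the two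
    sides. *)
Lemma cauchy_schwarz (I : finType) (u v : I -> R) :
  (\sum_i u i * v i) ^+ 2 <= (\sum_i u i ^+ 2) * (\sum_i v i ^+ 2).
Proof.
have h : 0 <= \sum_i \sum_j (u i * v j - u j * v i) ^+ 2.
  by apply: sumr_ge0 => i _; apply: sumr_ge0 => j _; exact: sqr_ge0.
have e1 : \sum_i \sum_j u i ^+ 2 * v j ^+ 2 = (\sum_i u i ^+ 2) * (\sum_i v i ^+ 2).
  by rewrite big_distrlr.
have e2 : \sum_i \sum_j u j ^+ 2 * v i ^+ 2 = (\sum_i u i ^+ 2) * (\sum_i v i ^+ 2).
  by rewrite exchange_big.
have e3 : \sum_i \sum_j (u i * v i) * (u j * v j) = (\sum_i u i * v i) ^+ 2.
  by rewrite expr2 big_distrlr.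
have key : 2 * ((\sum_i u i ^+ 2) * (\sum_i v i ^+ 2) - (\sum_i u i * v i) ^+ 2) =
    \sum_i \sum_j (u i * v j - u j * v i) ^+ 2.
  rewrite mulrBr mulr_natl mulr2n -{1}e1 -e2 -e3 mulr_sumr -big_split -sumrB /=.
  apply: eq_bigr => i _; rewrite mulr_sumr -big_split -sumrB /=.
  by apply: eq_bigr => j _; ring.
by rewrite -subr_ge0 -(pmulr_rge0 _ (ltr0Sn R 1)) key.
Qed.

Lemma dot_sqr x : \sum_k x k ord0 ^+ 2 = dot x x.
Proof. by apply: eq_bigr => k _; rewrite expr2. Qed.

Lemma dot_cauchy x y : (dot x y) ^+ 2 <= dot x x * dot y y.
Proof.
have := cauchy_schwarz (fun k => x k ord0) (fun k => y k ord0).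
by rewrite !dot_sqr.
Qed.

Lemma mxpowD P j k : mxpow P (j + k) = mxpow P j *m mxpow P k.
Proof. by elim: j => [|j IH] /=; rewrite ?mul1mx // IH mulmxA. Qed.

Lemma mxpowSr P k : mxpow P k.+1 = mxpow P k *m P.
Proof. by rewrite -addn1 mxpowD /= mulmx1. Qed.

Lemma mxpow_sym P k : P^T = P -> (mxpow P k)^T = mxpow P k.
Proof.
move=> PT; elim: k => [|k IH]; first by rewrite trmx1.
by rewrite {1}mxpowSr trmx_mul IH PT.
Qed.

Lemma trace_sqr_ge0 Q : Q^T = Q -> 0 <= \tr (Q *m Q).
Proof.
move=> QT; apply: sumr_ge0 => i _; rewrite mxE; apply: sumr_ge0 => j _.
by rewrite -{2}QT mxE -expr2 sqr_ge0.
Qed.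

Lemma dot_frobenius Q x : Q^T = Q -> dot x x = 1 -> dot (Q *m x) (Q *m x) <= \tr (Q *m Q).
Proof.
move=> QT x1; apply: ler_sum => i _; rewrite -expr2 !mxE.
apply: (le_trans (cauchy_schwarz _ _)).
rewrite [X in _ * X](_ : _ = 1) ?mulr1; last first.
  by rewrite -x1; apply: eq_bigr => k _; rewrite expr2.
have QE j : Q j i = Q i j by rewrite -{1}QT mxE.
by under [X in _ <= X]eq_bigr do rewrite QE -expr2.
Qed.

(* Iterated Cauchy-Schwarz replaces the spectral theorem: for a unit vector x,
   (x^T P^(2^j) x)^2 <= x^T P^(2^(j+1)) x. *)
Lemma unit_vector_power P x j : P^T = P -> 0 <= dot x (P *m x) -> dot x x = 1 ->
  (dot x (P *m x)) ^+ (2 ^ j.+1) <= \tr (mxpow P (2 ^ j.+1)).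
Proof.
move=> PT q0 x1.
have stp k : (dot x (mxpow P k *m x)) ^+ 2 <= dot (mxpow P k *m x) (mxpow P k *m x).
  by apply: (le_trans (dot_cauchy _ _)); rewrite x1 mul1r.
have dd k : dot (mxpow P k *m x) (mxpow P k *m x) = dot x (mxpow P (k + k) *m x).
  by rewrite mxpowD -mulmxA [RHS]dot_mulmx mxpow_sym.
have ind i : (dot x (P *m x)) ^+ (2 ^ i) <= dot x (mxpow P (2 ^ i) *m x).
  elim: i => [|i IH]; first by rewrite expn0 expr1 /= mulmx1.
  have -> : (2 ^ i.+1 = 2 ^ i + 2 ^ i)%N by rewrite expnS mul2n addnn.
  rewrite -dd; apply: le_trans (stp _).
  by rewrite exprD -expr2 lerXn2r // nnegrE ?exprn_ge0 // (le_trans _ IH) ?exprn_ge0.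
have -> : (2 ^ j.+1 = 2 ^ j + 2 ^ j)%N by rewrite expnS mul2n addnn.
rewrite mxpowD; apply: le_trans (dot_frobenius (mxpow_sym _ PT) x1).
apply: le_trans (stp _).
by rewrite exprD -expr2 lerXn2r // nnegrE ?exprn_ge0 // (le_trans _ (ind j)) ?exprn_ge0.
Qed.

Lemma gram_sym M : (M^T *m M)^T = M^T *m M.
Proof. by rewrite trmx_mul trmxK. Qed.

Lemma trace_gram_ge0 M j : 0 <= \tr (mxpow (M^T *m M) (2 ^ j.+1)).
Proof.
have -> : (2 ^ j.+1 = 2 ^ j + 2 ^ j)%N by rewrite expnS mul2n addnn.
rewrite mxpowD; apply: trace_sqr_ge0; apply: mxpow_sym; exact: gram_sym.
Qed.

Lemma rho_le M j (L : R) : 0 <= L ->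
  \tr (mxpow (M^T *m M) (2 ^ j.+1)) <= L ^+ (2 ^ j.+2) -> rho M <= L.
Proof.
move=> L0 trL; rewrite /rho.
set E := (fun r : R => _).
(* For n = 0 there is no unit vector, and the supremum of the empty set is 0. *)
have [->|/set0P ne] := eqVneq (E : set R) classical_sets.set0; first by rewrite sup0.
apply: ge_sup => // r [x [x1 ->]].
have x1' : dot x x = 1 by rewrite -x1; apply: eq_bigr => k _; rewrite expr2.
have qE : dot x (M^T *m M *m x) = \sum_k ((M *m x) k ord0) ^+ 2.
  by rewrite -mulmxA dot_mulmx trmxK; apply: eq_bigr => k _; rewrite expr2.
have q0 : 0 <= dot x (M^T *m M *m x) by rewrite qE sumr_ge0 // => k _; exact: sqr_ge0.
rewrite -qE.
have := le_trans (unit_vector_power j (gram_sym M) q0 x1') trL.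
have e2 : (2 ^ j.+2 = 2 * 2 ^ j.+1)%N by rewrite expnS.
rewrite e2 exprM ler_pXn2r ?nnegrE ?exprn_ge0 ?expn_gt0 // => h.
by apply: (le_trans (ler_wsqrtr h)); rewrite sqrtr_sqr ger0_norm.
Qed.
End Spectral.

(** * Markov's inequality in the model *)

Section Markov.
Variables (R : realType) (n d : nat) (a b : R).
Hypothesis b0 : 0 < b.
Hypothesis ba : b <= a.
Notation Ex := (expectation d a b).

Lemma weight_ge0 s (H : hgraph n) : 0 <= weight d a b s H.
Proof.
rewrite /weight mulr_ge0 ?invr_ge0 ?exprn_ge0 //; apply: prodr_ge0 => e _.
by case: ifP => _; rewrite ?subr_ge0; [exact: ep_ge0 | exact: ep_le1].
Qed.

Lemma expectation1 : Ex (fun (_ : spins n) _ => 1 : R) = 1.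
Proof.
rewrite /expectation -[RHS](PS_set0 n d a b) /PS; apply: eq_bigr => s _.
rewrite big_set0 mulr1 -[RHS]mulr1 /weight.
under eq_bigr do rewrite mulr1.
rewrite -mulr_sumr big_subset_distr; congr (_ * _).
by rewrite big1 // => e _; rewrite addrC subrK.
Qed.

Lemma Prob_le1 (E : spins n -> hgraph n -> Prop) : Prob d a b n E <= 1.
Proof.
rewrite -expectation1 /expectation /Prob; apply: ler_sum => s _; apply: ler_sum => H _.
by rewrite mulr1; case: ifP => _ //; exact: weight_ge0.
Qed.

(** The dominating function is kept explicit, so that a union bound becomes a sum of such
    functions. *)
Lemma Prob_ge (E : spins n -> hgraph n -> Prop) (f : spins n -> hgraph n -> R) :
  (forall s H, 0 <= f s H) -> (forall s H, ~ E s H -> 1 <= f s H) ->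
  1 - Ex f <= Prob d a b n E.
Proof.
move=> f0 f1; rewrite -expectation1 /expectation /Prob -sumrB; apply: ler_sum => s _.
rewrite -sumrB; apply: ler_sum => H _; rewrite mulr1.
have w0 := weight_ge0 s H.
case: asboolP => [_|/f1 h].
  by rewrite lerBlDr lerDl mulr_ge0.
by rewrite subr_le0 ler_peMr.
Qed.
End Markov.

Section Asymptotics.
Variable R : realType.
Local Open Scope classical_set_scope.

(** With eta * l <= ln n, the exponential series bounds (l+1)^(2p) by a constant times n; thus (K
    (l+1)^p)^2 = O(n), which is eventually below (e n)^2. *)
Lemma polylog_small (lseq : nat -> nat) (C : R) :
  (\forall n \near \oo, (lseq n)%:R <= C * ln (n%:R)) ->
  forall p (K e : R), 0 <= K -> 0 < e ->
    \forall n \near \oo, K * (lseq n).+1%:R ^+ p <= e * n%:R.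
Proof.
move=> lC p K e K0 e0.
pose eta : R := (`|C| + 1)^-1.
have C1 : 0 < `|C| + 1 by rewrite ltr_wpDl.
have eta0 : 0 < eta by rewrite invr_gt0.
pose c : R := (p.*2.+1)`!%:R * expR eta / eta ^+ p.*2.+1.
near=> n.
have n1 : (0 < n)%N by near: n; exists 1%N.
have n0 : 0 < n%:R :> R by rewrite ltr0n.
have ln0 : 0 <= ln (n%:R : R) by rewrite ln_ge0 // ler1n.
have ll : eta * (lseq n)%:R <= ln n%:R.
  have h : (lseq n)%:R <= C * ln (n%:R : R) by near: n.
  rewrite /eta mulrC ler_pdivrMr // (le_trans h) // mulrC ler_wpM2l //.
  by rewrite (le_trans (ler_norm _)) // lerDl.
set y : R := (lseq n).+1%:R.
have y1 : 1 <= y by rewrite ler1n.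
have y0 : 0 <= y by rewrite (le_trans ler01).
have big : y ^+ p.*2.+1 <= c * n%:R.
  have /(le_trans _) := expR_ge1Dxn p.*2 (mulr_ge0 (ltW eta0) y0).
  move=> /(_ ((eta * y) ^+ p.*2.+1 / (p.*2.+1)`!%:R)); rewrite lerDr ler01 => /(_ isT).
  have -> : expR (eta * y) = expR eta * expR (eta * (lseq n)%:R).
    by rewrite -expRD /y -natr1 mulrDr mulr1 addrC.
  move=> h.
  have {}h : (eta * y) ^+ p.*2.+1 / (p.*2.+1)`!%:R <= expR eta * n%:R.
    apply: (le_trans h); rewrite ler_wpM2l ?expR_ge0 //.
    by rewrite -[X in _ <= X](lnK (x := n%:R)) ?posrE // ler_expR.
  have f0 : 0 < (p.*2.+1)`!%:R :> R by rewrite ltr0n fact_gt0.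
  move: h; rewrite ler_pdivrMr // exprMn => h.
  rewrite /c -mulrA [eta ^- _ * _]mulrC mulrA ler_pdivlMr ?exprn_gt0 // mulrC.
  by apply: (le_trans h); rewrite le_eqVlt; apply/orP; left; apply/eqP; ring.
have sq : (K * y ^+ p) ^+ 2 <= (e * n%:R) ^+ 2.
  rewrite !exprMn -exprM muln2.
  apply: (@le_trans _ _ (K ^+ 2 * (c * n%:R))).
    by rewrite ler_wpM2l ?sqr_ge0 // (le_trans _ big) // ler_weXn2l.
  rewrite mulrA [X in _ <= _ * X]expr2 [X in _ <= X]mulrA ler_wpM2r //.
  have : K ^+ 2 * c / e ^+ 2 <= n%:R by near: n; exact: nbhs_infty_ger.
  by rewrite ler_pdivrMr ?exprn_gt0 // mulrC [X in _ <= X]mulrC mulrC.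
by rewrite ler_pXn2r ?nnegrE ?mulr_ge0 ?exprn_ge0 // ?ltW in sq.
Unshelve. all: by end_near.
Qed.

Lemma cvg_to1 (P : nat -> R) :
  (forall n, P n <= 1) ->
  (forall e : R, 0 < e -> \forall n \near \oo, 1 - e <= P n) ->
  P @ \oo --> (1 : R).
Proof.
move=> P1 Pe; apply/cvgrPdist_le => e e0; have := Pe e e0.
apply: filterS => n h; rewrite ger0_norm ?subr_ge0 //.
by rewrite lerBlDr addrC -lerBlDr.
Qed.
End Asymptotics.

(** * Choice of the discount, and the tail bound for one matrix *)

Section Tail.
Variables (R : realType) (d : nat) (a b : R) (j : nat).
Hypothesis d1 : (1 < d)%N.
Hypothesis b0 : 0 < b.
Hypothesis ba : b <= a.
Hypothesis alp1 : 1 <= alpha d a b.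
Notation alp := (alpha d a b).
Let k := (2 ^ j.+1)%N.
Let C1 : R := (d ^ 2)%:R * a.

(** Bounds the steps plus the seen vertices of a chain of 2k words of length l. *)
Definition length_scale l : nat := (2 * k * d.+1 * l.+1)%N.
(** The value of Theta: two powers cover the quadratic one-step budget, the third makes delta the
    inverse of the length scale. *)
Definition charge_rate l : R := (3 + 2 * C1 + d%:R) * (length_scale l)%:R ^+ 3.

Let a0 : 0 <= a. Proof. exact: le_trans (ltW b0) ba. Qed.
Let C10 : 0 <= C1. Proof. by rewrite mulr_ge0. Qed.

Lemma length_scale_ge1 l : 1 <= (length_scale l)%:R :> R.
Proof. by rewrite ler1n !muln_gt0 expn_gt0. Qed.

Lemma charge_rate_ge1 l : 1 <= charge_rate l.
Proof.
have h : 1 <= (length_scale l)%:R ^+ 3 :> R by rewrite exprn_ege1 // length_scale_ge1.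
apply: (le_trans h); rewrite ler_peMl ?(le_trans ler01 h) //.
have := ler0n R d; have := C10; lra.
Qed.

Lemma charge_rateR l (V : nat) : (V <= length_scale l)%N ->
  (charge_rate l)^-1 * (2 + C1 + (V * V)%:R + C1 * V%:R + (d * V)%:R)
    <= ((length_scale l)%:R)^-1.
Proof.
move=> VL; set L : R := (length_scale l)%:R.
have L1 : 1 <= L := length_scale_ge1 l.
have L0 : 0 < L by exact: lt_le_trans ltr01 L1.
have K0 : 0 < 3 + 2 * C1 + d%:R by have := ler0n R d; have := C10; lra.
have VR : V%:R <= L by rewrite ler_nat.
have V0 : 0 <= V%:R :> R by [].
rewrite mulrC ler_pdivrMr ?mulr_gt0 ?exprn_gt0 //.
rewrite [X in _ <= X](_ : _ = (3 + 2 * C1 + d%:R) * L ^+ 2); last first.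
  by rewrite /charge_rate -/L; field; rewrite gt_eqF.
have LL : 1 <= L ^+ 2 by rewrite exprn_ege1.
have L2 : L <= L ^+ 2 by rewrite expr2 ler_peMl // ltW.
have VV : V%:R * V%:R <= L ^+ 2 by rewrite expr2 ler_pM.
have CV : C1 * V%:R <= C1 * L ^+ 2 by rewrite ler_wpM2l // (le_trans VR).
have CL : C1 <= C1 * L ^+ 2 by rewrite ler_peMr.
have dV : d%:R * V%:R <= d%:R * L ^+ 2 :> R by rewrite ler_wpM2l // (le_trans VR).
rewrite !natrM; move: VV CV CL dV LL.
move: (L ^+ 2) (V%:R * V%:R) (C1 * V%:R) (d%:R * V%:R) => Q q1 q2 q3.
rewrite !mulrDl -mulrA; lra.
Qed.

Variables (n l : nat).
Hypothesis n0 : (0 < n)%N.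
Notation Theta := (charge_rate l).
Hypothesis ThetaR : Theta ^+ (8 + 4 * (6 * k)) <= n%:R.

(** The exponent of Theta for 2k copies with at most three jumps each, J = 6k, and at most 2k
    guaranteed collisions. *)
Definition tail_exp : nat := (4 + 4 * (6 * k) + (8 + 4 * (6 * k)) * (2 * k))%N.

Lemma expected_gram_trace (c ct : copy n) g F :
  (forall s H, mcopy d a b s H ct = (mcopy d a b s H c)^T) ->
  csize c = l -> csize ct = l -> gain d c g -> gain d ct g ->
  (njumps (cprog c) <= 3)%N -> (njumps (cprog ct) <= 3)%N ->
  (count_mem cen (ckinds c) + (count_mem non (ckinds c)).*2 <= F)%N ->
  (count_mem cen (ckinds ct) + (count_mem non (ckinds ct)).*2 <= F)%N ->
  expectation d a b (fun s H => \tr (mxpow ((mcopy d a b s H c)^T *m mcopy d a b s H c) k)) <=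
  n%:R * expR 1 * (Theta ^+ (4 + 4 * (6 * k)) *
     (Theta ^+ (8 + 4 * (6 * k)) / n%:R) ^+ (2 * k * g) * alp ^+ (k * F)).
Proof.
move=> trE sc sct gc gct jc jct fc fct.
pose pc := pow_copy (cat_copy ct c) k.
have szp : csize pc = (k * (l + l))%N by rewrite csize_pow csize_cat sc sct.
pose V := (1 + d * csize pc + csize pc)%N.
have VL : (V <= length_scale l)%N.
  rewrite /V szp /length_scale.
  have k0 : (0 < k)%N by rewrite expn_gt0.
  by move: k0; move: k => kk k0; nia.
have T0 : Theta != 0 by rewrite gt_eqF // (lt_le_trans ltr01) // charge_rate_ge1.
have := @expected_trace R n d a b Theta^-1 Theta ((length_scale l)%:R)^-1 C1 V d1 b0 ba alp1 n0
   erefl (charge_rate_ge1 l) (mulVf T0) (charge_rateR VL) pc (2 * k * g) (6 * k) (k * F).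
rewrite (@eq_expectation R n d a b _ (fun s H =>
   \tr (mxpow ((mcopy d a b s H c)^T *m mcopy d a b s H c) k))); last first.
  by move=> s H; rewrite mcopy_pow mcopy_cat trE.
move=> h; apply: (le_trans (h _ _ _ ThetaR _ _)).
- have -> : (2 * k * g = k * (g + g))%N by lia.
  by apply: gain_pow; exact: gain_cat.
- rewrite njumps_pow mulnC leq_mul2r; apply/orP; right.
  by rewrite njumps_cat (leq_add jct jc).
- rewrite !count_ckinds_pow !count_ckinds_cat.
  have := leq_mul (leqnn k) (leq_add fc fct); lia.
- by rewrite /V -addnA leq_addr.
- by rewrite /V leq_addl.
rewrite ler_wpM2r ?bound_ge0 ?charge_rate_ge1 //.
rewrite ler_wpM2l //.
(* By 1 + x <= e^x and at most [length_scale l] steps, the kernel sum costs a factor e. *)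
apply: (@le_trans _ _ (expR ((length_scale l)%:R^-1) ^+ csize pc)).
  have q0 : 0 <= 1 + (length_scale l)%:R^-1 :> R by rewrite addr_ge0 // invr_ge0.
  by apply: lerXn2r; rewrite ?nnegrE ?expR_ge0 ?expR_ge1Dx.
rewrite -expRM_natl ler_expR mulrC ler_pdivrMl ?mulr1; last first.
  exact: lt_le_trans ltr01 (length_scale_ge1 l).
by rewrite ler_nat; apply: leq_trans VL; rewrite leq_addl.
Qed.

(** The function is the trace divided by L^(2k), where L is the claimed norm bound, so it is at
    least one when the bound fails. In its expectation n^(-2kg) cancels, and n^(2k eps) >= n^2
    absorbs the factor n of the trace and leaves 1/n. *)
Lemma spectral_tail (c ct : copy n) g F F' (eps : R) :
  (forall s H, mcopy d a b s H ct = (mcopy d a b s H c)^T) ->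
  csize c = l -> csize ct = l -> gain d c g -> gain d ct g -> (g <= 1)%N ->
  (njumps (cprog c) <= 3)%N -> (njumps (cprog ct) <= 3)%N ->
  (count_mem cen (ckinds c) + (count_mem non (ckinds c)).*2 <= F)%N ->
  (count_mem cen (ckinds ct) + (count_mem non (ckinds ct)).*2 <= F)%N ->
  (F <= F')%N -> 2 <= (2 * k)%:R * eps ->
  exists f : spins n -> hgraph n -> R,
    [/\ forall s H, 0 <= f s H,
        forall s H, ~ (rho (mcopy d a b s H c) <=
            n%:R `^ (eps - g%:R) * alp `^ (F'%:R / 2)) -> 1 <= f s H &
        expectation d a b f <= expR 1 * Theta ^+ tail_exp / n%:R].
Proof.
move=> trE sc sct gc gct g1 jc jct fc fct FF ke.
set L := n%:R `^ _ * _.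
have nR : 0 < n%:R :> R by rewrite ltr0n.
have aR : 0 < alp by exact: lt_le_trans ltr01 alp1.
have L0 : 0 < L by rewrite mulr_gt0 ?powR_gt0.
have k2 : (2 ^ j.+2 = 2 * k)%N by rewrite expnS.
have LE : L ^+ (2 * k) * n%:R ^+ (2 * k * g) =
    n%:R `^ ((2 * k)%:R * eps) * alp ^+ (k * F').
  rewrite exprMn -!powR_mulrn ?powR_ge0 ?ltW // -!powRrM mulrAC; congr (_ * _).
    rewrite -powRD; last by rewrite (gt_eqF nR) implybT.
    by congr (_ `^ _); rewrite !natrM; ring.
  by congr (_ `^ _); rewrite !natrM; field.
exists (fun s H => (L ^+ (2 * k))^-1 *
   \tr (mxpow ((mcopy d a b s H c)^T *m mcopy d a b s H c) k)); split.
- by move=> s H; rewrite mulr_ge0 ?invr_ge0 ?exprn_ge0 ?(ltW L0) // trace_gram_ge0.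
- move=> s H /negP; apply: contraNle => /ltW h.
  apply: (@rho_le _ _ _ j); first exact: ltW.
  by move: h; rewrite k2 mulrC ler_pdivrMr ?exprn_gt0 // mul1r.
rewrite expectationZ ler_pdivrMl ?exprn_gt0 //.
apply: (le_trans (expected_gram_trace trE sc sct gc gct jc jct fc fct)).
have T1 := charge_rate_ge1 l; have T0 : 0 <= Theta by exact: le_trans ler01 T1.
have nN : 0 < n%:R ^+ (2 * k * g) :> R by rewrite exprn_gt0.
rewrite -(ler_pM2r nN) [X in _ <= X](_ : _ = (L ^+ (2 * k) * n%:R ^+ (2 * k * g)) *
   (expR 1 * Theta ^+ tail_exp / n%:R)); last by ring.
rewrite LE expr_div_n [X in X <= _](_ : _ = expR 1 *
   (Theta ^+ (4 + 4 * (6 * k)) * Theta ^+ (8 + 4 * (6 * k)) ^+ (2 * k * g)) *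
   (n%:R * alp ^+ (k * F))); last first.
  by field; rewrite gt_eqF.
rewrite [X in _ <= X](_ : _ = expR 1 * Theta ^+ tail_exp *
   (n%:R `^ ((2 * k)%:R * eps) / n%:R * alp ^+ (k * F'))); last by ring.
apply: ler_pM.
- by apply: mulr_ge0; [exact: expR_ge0 | apply: mulr_ge0; do 2?[apply: exprn_ge0]].
- by rewrite mulr_ge0 ?exprn_ge0 // ltW.
- rewrite ler_wpM2l ?expR_ge0 // -exprM -exprD ler_weXn2l // /tail_exp leq_add2l.
  by rewrite leq_mul2l -[X in (_ <= X)%N]muln1 leq_mul2l g1 !orbT.
- apply: ler_pM; [by [] | by apply: exprn_ge0; exact: ltW | | ]; last first.
    by rewrite ler_weXn2l // leq_mul2l FF orbT.
  rewrite ler_pdivlMr // -expr2 -(powR_mulrn 2 (ltW nR)).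
  by rewrite ler_powR // ler1n.
Qed.
End Tail.

(** * Union over the remainders, and the limit *)

Unset Implicit Arguments.
Local Open Scope classical_set_scope.

Theorem theorem3p1 (R : realType) (d : nat) (a b : R) :
  (3 <= d)%N -> 0 < b -> b <= a -> 1 < alpha d a b -> 1 < beta d a b ->
  exists Gamma : forall n : nat, nat -> nat -> spins n -> hgraph n -> 'M[R]_n,
    (forall (n : nat) (s : spins n) (H : hgraph n), H \subset dsets d n ->
       forall l : nat, (1 <= l)%N ->
         Bmat d H l =
           Delta d a b s H l
           + \sum_(1 <= m < l.+1)
                (Delta d a b s H (l - m) *m Abar d a b s *m Bmat d H m.-1)
           - \sum_(1 <= m < l.+1) Gamma n l m s H)
    /\
    (forall lseq : nat -> nat,
       (exists C : R, \forall n \near \oo, (lseq n)%:R <= C * ln (n%:R)) ->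
       forall eps : R, 0 < eps ->
         ((fun n : nat => Prob d a b n (fun s H =>
              rho (Delta d a b s H (lseq n))
                <= (n%:R) `^ eps * (alpha d a b) `^ ((lseq n)%:R / 2)))
            @ \oo --> (1 : R))
         /\
         ((fun n : nat => Prob d a b n (fun s H =>
              forall m : nat, (1 <= m <= lseq n)%N ->
                rho (Gamma n (lseq n) m s H)
                  <= (n%:R) `^ (eps - 1)
                     * (alpha d a b) `^ (((lseq n + m)%N)%:R / 2)))
            @ \oo --> (1 : R))).
Proof.
have split_len m l : (1 <= m <= l)%N ->
    [/\ (l - m + m.-1.+1 = l)%N, (m.-1 + (l - m).+1 = l)%N & (l - m + m.-1.*2 <= l + m)%N].
  by move=> ml; split; lia.
move=> d3 b0 ba alp1 _; have d1 : (1 < d)%N := ltnW d3.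
exists (fun n l m s H => mcopy d a b s H (gap_copy n d cen (l - m) non m.-1)).
split=> [n s H _ l l1|lseq [C lC] eps eps0]; first exact: Bmat_decomposition.
(* 2k = 2^(j+2) exceeds j, hence 2/eps; a power of two is what the iterated squaring in [rho_le]
   handles. *)
pose j := Num.bound (2 / eps).
pose k := (2 ^ j.+1)%N.
have ke : 2 <= (2 * k)%:R * eps.
  rewrite -ler_pdivrMr //; apply: (le_trans (ltW (archi_boundP _))); first by rewrite divr_ge0 // ltW.
  rewrite ler_nat /k -expnS; apply: (leq_trans (ltnW (ltn_expl _ (ltnSn 1)))).
  by apply: leq_pexp2l => //; exact: leqW (leqnSn j).
have alp1' := ltW alp1.
pose Th l := charge_rate d a j l.
pose K0 : R := (3 + 2 * ((d ^ 2)%:R * a) + d%:R) * (2 * k * d.+1)%:R ^+ 3.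
have ThE l : Th l = K0 * l.+1%:R ^+ 3.
  by rewrite /Th /charge_rate /length_scale -/k (natrM _ (2 * k * d.+1)) exprMn /K0 -[RHS]mulrA.
have a0 : 0 <= a by exact: le_trans (ltW b0) ba.
have K00 : 0 <= K0 by rewrite mulr_ge0 ?exprn_ge0 // !addr_ge0 ?mulr_ge0.
have Th0 l : 0 <= Th l by rewrite ThE mulr_ge0 ?exprn_ge0.
have tl0 n l A : 0 <= expR 1 * Th l ^+ A / n%:R.
  by rewrite divr_ge0 // mulr_ge0 ?expR_ge0 // exprn_ge0.
(* The factor [(lseq n).+1] is reserved for the union bound over [m]. *)
have rate q (K e : R) : 0 <= K -> 0 < e ->
    \forall n \near \oo, (lseq n).+1%:R * (K * Th (lseq n) ^+ q) <= e * n%:R.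
  move=> Kge e0; have := polylog_small lC (3 * q).+1 (mulr_ge0 Kge (exprn_ge0 q K00)) e0.
  apply: filterS => n; apply: le_trans; rewrite le_eqVlt; apply/orP; left; apply/eqP.
  by rewrite ThE exprMn -exprM exprS; ring.
pose A := tail_exp j.
have small (e : R) : 0 < e -> \forall n \near \oo,
    [/\ (0 < n)%N, Th (lseq n) ^+ (8 + 4 * (6 * k)) <= n%:R &
        (lseq n).+1%:R * (expR 1 * Th (lseq n) ^+ A / n%:R) <= e].
  move=> e0; near=> n.
  have n0 : (0 < n)%N by near: n; exists 1%N.
  have nR : 0 < n%:R :> R by rewrite ltr0n.
  have h1 : (lseq n).+1%:R * (1 * Th (lseq n) ^+ (8 + 4 * (6 * k))) <= 1 * n%:R.
    by near: n; apply: rate.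
  have h2 : (lseq n).+1%:R * (expR 1 * Th (lseq n) ^+ A) <= e * n%:R.
    by near: n; apply: rate => //; exact: expR_ge0.
  split=> //; last by rewrite [X in X <= _]mulrA ler_pdivrMr.
  move: h1; rewrite !mul1r; apply: le_trans; rewrite ler_peMl ?ler1n //.
  by rewrite exprn_ge0.
split.
- apply: cvg_to1 => [n|e e0]; first exact: Prob_le1.
  have := small e e0; apply: filterS => n [n0 Th8 tl].
  have nR : 0 < n%:R :> R by rewrite ltr0n.
  have nc : cen != bri by [].
  have := @spectral_tail R d a b j d1 b0 ba alp1' n (lseq n) n0 Th8
    (walk_copy n d cen (lseq n)) (walk_copy n d cen (lseq n)) 0 (lseq n) (lseq n) eps.
  case.
  + by move=> s H; rewrite mcopy_walk_tr.
  + exact: csize_walk.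
  + exact: csize_walk.
  + exact: gain_walk.
  + exact: gain_walk.
  + by [].
  + exact: leq_trans (njumps_walk _ _ _ nc) _.
  + exact: leq_trans (njumps_walk _ _ _ nc) _.
  + by rewrite !count_walk /= mul1n mul0n addn0.
  + by rewrite !count_walk /= mul1n mul0n addn0.
  + by [].
  + exact: ke.
  move=> f [f0 f1 fE]; apply: (@le_trans _ _ (1 - expectation d a b f)); last first.
    by apply: Prob_ge => // s H nE; apply: f1; rewrite subr0 -Delta_mcopy.
  rewrite lerD2l lerN2 (le_trans fE) // (le_trans _ tl) //.
  by rewrite ler_peMl ?ler1n // tl0.
- apply: cvg_to1 => [n|e e0]; first exact: Prob_le1.
  have := small e e0; apply: filterS => n [n0 Th8 tl].
  set l := lseq n in Th8 tl *.
  have nc : cen != bri by []. have nn : non != bri by [].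
  (* The range condition sits under the existential so that [choice] yields one family indexed by
     all [m]; outside the range zero serves. *)
  have tail m : exists f : spins n -> hgraph n -> R, (1 <= m <= l)%N ->
    [/\ forall s H, 0 <= f s H,
        forall s H, ~ (rho (mcopy d a b s H (gap_copy n d cen (l - m) non m.-1)) <=
            n%:R `^ (eps - 1) * alpha d a b `^ ((l + m)%:R / 2)) -> 1 <= f s H &
        expectation d a b f <= expR 1 * Th l ^+ A / n%:R].
    case: (boolP (1 <= m <= l)%N) => [/split_len [len1 len2 len3]|_]; last by exists (fun _ _ => 0).
    have := @spectral_tail R d a b j d1 b0 ba alp1' n l n0 Th8
      (gap_copy n d cen (l - m) non m.-1) (gap_copy n d non m.-1 cen (l - m))
      1 ((l - m) + m.-1.*2) (l + m) eps.
    case.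
    + by move=> s H; rewrite mcopy_gap_tr.
    + by rewrite csize_gap.
    + by rewrite csize_gap.
    + exact: gain_gap.
    + exact: gain_gap.
    + by [].
    + exact: njumps_gap.
    + exact: njumps_gap.
    + by rewrite !count_gap //= !mul1n !mul0n add0n addn0.
    + by rewrite !count_gap //= !mul1n !mul0n add0n addn0.
    + exact: len3.
    + exact: ke.
    by move=> f hf; exists f.
  have [f fP] := choice tail.
  pose F s H := \sum_(1 <= m < l.+1) f m s H.
  have fm m : (1 <= m < l.+1)%N -> (1 <= m <= l)%N by rewrite ltnS.
  have F0 s H : 0 <= F s H.
    by rewrite /F big_nat; apply: sumr_ge0 => m /fm /fP [f0 _ _].
  apply: (@le_trans _ _ (1 - expectation d a b F)); last first.
    apply: Prob_ge => // s H /existsNP [m /not_implyP [ml nE]].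
    have [f0 f1 _] := fP m ml; apply: (le_trans (f1 s H nE)).
    rewrite /F (bigD1_seq m) ?mem_index_iota ?iota_uniq ?ltnS //= lerDl big_seq_cond.
    apply: sumr_ge0 => i; rewrite mem_index_iota => /andP [/fm il _].
    by have [g0 _ _] := fP i il.
  rewrite lerD2l lerN2 /F expectation_sum (le_trans _ tl) //.
  apply: (@le_trans _ _ (\sum_(1 <= m < l.+1) expR 1 * Th l ^+ A / n%:R)).
    by rewrite !big_nat; apply: ler_sum => m /fm /fP [_ _].
  by rewrite sumr_const_nat subn1 /= -[X in X <= _]mulr_natl ler_wpM2r ?ler_nat ?tl0.
Unshelve. all: by end_near.
Qed.
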